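(* Define polynomials $\overline{P}_n(x)$ by $\overline{P}_0(x)=1$ and, for $n\ge1$, \[\overline{P}_{n}(x)=\frac{x}{n}\sum_{k=1}^{n} \overline{\sigma}(k)\, \overline{P}_{n-k}(x),\] where for a positive integer $n=2^m l$ with $l$ odd, $\overline{\sigma}(n)=2^{m+1}\sigma(l)$ and $\sigma(l)=\sum_{d\mid l} d$. Then, as formal power series in $q$ (and for $|q|<1$), \[\sum_{n=0}^{\infty} \overline{P}_{n}(x)q^{n}=\Big(\prod_{n=1}^{\infty}\frac{1+q^n}{1-q^{n}}\Big)^x,\] and for every $n\ge1$ the derivative of $\overline{P}_n(x)$ satisfies \[\overline{P}_{n}^{\prime}(x)=\sum_{k=1}^{n} \frac{\overline{\sigma}(k)}{k}\, \overline{P}_{n-k}(x).\] *)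

(* Defs.v *)
From HB Require Import structures.
From mathcomp Require Export all_boot all_order all_algebra.
From mathcomp Require Export all_classical all_reals all_analysis.
From mathcomp Require Export complex.

Set Implicit Arguments.
Unset Strict Implicit.
Unset Printing Implicit Defensive.

Export Order.TTheory GRing.Theory Num.Theory.
Export numFieldNormedType.Exports.

#[global] Open Scope classical_set_scope.
#[global] Open Scope complex_scope.
#[global] Open Scope ring_scope.

Definition sigma (n : nat) : nat := (\sum_(d <- divisors n) d)%N.

(* For n = 2^m l with l odd, m = logn 2 n and l is the 2'-part of n. *)
Definition sigmabar (n : nat) : nat :=
  (2 ^ (logn 2 n).+1 * sigma n`_2^')%N.

Section Pbar.
Variable K : fieldType.

(* Pbar_rev n = [:: Pbar n; ...; Pbar 0]; the recurrence itself is recovered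
   in Pbar_rec below. *)
Fixpoint Pbar_rev (n : nat) : seq {poly K} :=
  if n is m.+1 then
    let s := Pbar_rev m in
    (n%:R^-1 *: ('X * \sum_(1 <= k < n.+1) (sigmabar k)%:R *: s`_k.-1)) :: s
  else [:: 1].

Definition Pbar (n : nat) : {poly K} := (Pbar_rev n)`_0.

Lemma nth_Pbar_rev (n i : nat) : (i <= n)%N -> (Pbar_rev n)`_i = Pbar (n - i).
Proof.
elim: n i => [|n IHn] [|i] //= le_in.
by rewrite subSS -IHn.
Qed.

Lemma Pbar0 : Pbar 0 = 1.
Proof. by []. Qed.

Lemma Pbar_rec (n : nat) : (0 < n)%N ->
  Pbar n = n%:R^-1 *: ('X * \sum_(1 <= k < n.+1) (sigmabar k)%:R *: Pbar (n - k)).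
Proof.
case: n => // n _; rewrite {1}/Pbar [LHS]/=; congr (_ *: (_ * _)).
rewrite !big_nat; apply: eq_bigr => -[|k] //= lt_kn.
by rewrite nth_Pbar_rev.
Qed.

End Pbar.

(* Formal power series in q over a commutative K-algebra A, given by their
   coefficients.  Everything is defined explicitly because the ring structure
   that nat -> A inherits from the library is the pointwise one. *)
Definition fps (A : Type) : Type := nat -> A.

Section FormalPowerSeries.
Variables (K : fieldType) (A : comAlgType K).
Implicit Types (f g : fps A).

Definition fps_Xn (m : nat) : fps A := fun n => (n == m)%:R.
Definition fps_one : fps A := fps_Xn 0.
Definition fps_add f g : fps A := fun n => f n + g n.
Definition fps_sub f g : fps A := fun n => f n - g n.
Definition fps_scale (a : A) f : fps A := fun n => a * f n.
Definition fps_mul f g : fps A := fun n => \sum_(i < n.+1) f i * g (n - i)%N.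
Definition fps_exp f (k : nat) : fps A := iter k (fps_mul f) fps_one.

(* \sum_k a_k g^k for g with zero constant term: the powers k > n of g do not
   contribute to the coefficient of q^n. *)
Definition fps_subst (a : nat -> K) g : fps A :=
  fun n => \sum_(k < n.+1) a k *: fps_exp g k n.

(* Inverse, logarithm and powers of series with constant term 1, the exponential
   of series with zero constant term.  In fps_logarithm the term k = 0 vanishes
   since 0^-1 = 0. *)
Definition fps_inv f : fps A := fps_subst (fun=> 1) (fps_sub fps_one f).
Definition fps_logarithm f : fps A :=
  fps_subst (fun k => (-1) ^+ k.+1 / k%:R) (fps_sub f fps_one).
Definition fps_exponential g : fps A := fps_subst (fun k => (k`!)%:R^-1) g.
Definition fps_pow f (x : A) : fps A :=
  fps_exponential (fps_scale x (fps_logarithm f)).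

Definition fps_overprod (N : nat) : fps A :=
  \big[fps_mul/fps_one]_(1 <= n < N.+1)
    fps_mul (fps_add fps_one (fps_Xn n)) (fps_inv (fps_sub fps_one (fps_Xn n))).

(* q-adic convergence: every coefficient is eventually constant. *)
Definition fps_cvg (u : nat -> fps A) f : Prop :=
  forall n, exists N0, forall N, (N0 <= N)%N -> u N n = f n.

End FormalPowerSeries.

Section Analytic.
Variable R : realType.
(* R[i]^o carries the topology of the complex modulus. *)
Local Notation C := (R[i]^o).

Definition cexp (z : C) : C :=
  let: a +i* b := z in (expR a * cos b) +i* (expR a * sin b).

Definition unit_disc : set C := [set q : C | `|q| < 1].

Definition overprod_part (q : C) (N : nat) : C :=
  \prod_(1 <= n < N.+1) ((1 + q ^+ n) / (1 - q ^+ n)).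

Definition overprod (q : C) : C := limn (overprod_part q).

(* L is the logarithm of F on the unit disc normalized by L 0 = 0; as the disc is
   connected there is at most one such L there, and F^x is exp (x L).  The
   principal logarithm of F q would not do for F = overprod: the imaginary part
   of L leaves ]-pi, pi] near the unit circle. *)
Definition disc_log (F L : C -> C) : Prop :=
  [/\ {within unit_disc, continuous L},
      L 0 = 0
    & forall q, unit_disc q -> cexp (L q) = F q].

End Analytic.

(* Main.v *)
(** Let theta = q d/dq.  A formal power series f with f(0) = 1 is determined by its
    logarithmic derivative s = theta f / f.  Every factor (1+q^n)/(1-q^n) has
    logarithmic derivative 2n q^n/(1-q^2n), so that of the product is
    S = \sum_k sigmabar(k) q^k, since sigmabar(k) is the sum of 2n over the divisors n of
    k with k/n odd.  The recurrence for Pbar says theta P = x S P, which is also satisfied by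
    the x-th power of the product, whence the formal identity; the derivative formula
    compares dP/dx with (\sum_k sigmabar(k)/k q^k) P, which solve the same linear equation.

    Analytically, if g has absolutely summable coefficients then the coefficients of its
    formal exponential sum to cexp (\sum_n g_n): the error of truncation is dominated
    coefficientwise by the one for |g|, and there monotonicity applies.  For each n this
    gives (1+q^n)/(1-q^n) as an exponential, hence the partial products as exponentials of
    power series converging to L(q) = \sum_k sigmabar(k)/k q^k, and it gives
    \sum_n P_n(x) q^n = cexp (x L(q)).  Any other continuous logarithm vanishing at 0
    agrees with L along each segment from 0. *)

From HB Require Import structures.
Require Import Defs.
From mathcomp Require Import ring lra zify.

Set Implicit Arguments.
Unset Strict Implicit.
Unset Printing Implicit Defensive.

(** * The ring of formal power series and the Euler operator *)

Section FpsRing.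
Variables (K : fieldType) (A : comAlgType K).
Implicit Types f g h : fps A.

HB.instance Definition _ := gen_eqMixin (fps A).
HB.instance Definition _ := gen_choiceMixin (fps A).

Let fps_opp f : fps A := fun n => - f n.
Let fps_zero : fps A := fun=> 0.

Let fps_addA : associative (@fps_add K A).
Proof. by move=> f g h; apply/funext => n; exact: addrA. Qed.
Let fps_addC : commutative (@fps_add K A).
Proof. by move=> f g; apply/funext => n; exact: addrC. Qed.
Let fps_add0 : left_id fps_zero (@fps_add K A).
Proof. by move=> f; apply/funext => n; exact: add0r. Qed.
Let fps_addN : left_inverse fps_zero fps_opp (@fps_add K A).
Proof. by move=> f; apply/funext => n; exact: addNr. Qed.

HB.instance Definition _ :=
  GRing.isZmodule.Build (fps A) fps_addA fps_addC fps_add0 fps_addN.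

Definition fps_trunc (n : nat) f : {poly A} := \poly_(i < n.+1) f i.

(** Coefficients up to n of a product see only the truncations, so commutativity and associativity
    can be borrowed from [{poly A}]. *)
Lemma fps_mul_trunc f g n m : (m <= n)%N ->
  fps_mul f g m = (fps_trunc n f * fps_trunc n g)`_m.
Proof.
move=> le_mn; rewrite coefM; apply: eq_bigr => i _; rewrite !coef_poly.
by rewrite !ifT // ltnS (leq_trans _ le_mn) // ?leq_subr // -ltnS.
Qed.

Lemma coef_trunc_fps_mul f g n m : (m <= n)%N ->
  (fps_trunc n (fps_mul f g))`_m = (fps_trunc n f * fps_trunc n g)`_m.
Proof. by move=> le_mn; rewrite coef_poly ltnS le_mn; exact: fps_mul_trunc. Qed.

Let fps_mulC : commutative (@fps_mul K A).
Proof. by move=> f g; apply/funext => n; rewrite !(fps_mul_trunc _ _ (leqnn n)) mulrC. Qed.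

Let fps_mulA : associative (@fps_mul K A).
Proof.
move=> f g h; apply/funext => n; rewrite !(fps_mul_trunc _ _ (leqnn n)).
transitivity (fps_trunc n f * (fps_trunc n g * fps_trunc n h))`_n.
  by rewrite !coefM; apply: eq_bigr => i _; rewrite coef_trunc_fps_mul ?leq_subr.
rewrite mulrA !coefM; apply: eq_bigr => i _.
by rewrite coef_trunc_fps_mul // -ltnS.
Qed.

Let fps_mul1 : left_id (@fps_one K A) (@fps_mul K A).
Proof.
move=> f; apply/funext => n; rewrite /fps_mul big_ord_recl /= mul1r subn0.
by rewrite big1 ?addr0 // => i _; rewrite mul0r.
Qed.

Let fps_mulD : left_distributive (@fps_mul K A) (@fps_add K A).
Proof.
move=> f g h; apply/funext => n; rewrite /fps_mul /fps_add -big_split.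
by apply: eq_bigr => i _; rewrite mulrDl.
Qed.

Let fps_1_neq0 : (@fps_one K A) != 0.
Proof. by apply/eqP => /(congr1 (@^~ 0%N)) /eqP; rewrite /= oner_eq0. Qed.

HB.instance Definition _ := GRing.Zmodule_isComNzRing.Build (fps A)
  fps_mulA fps_mulC fps_mul1 fps_mulD fps_1_neq0.

Lemma fps_addE f g : fps_add f g = f + g. Proof. by []. Qed.
Lemma fps_mulE f g : fps_mul f g = f * g. Proof. by []. Qed.
Lemma fps_oneE : fps_one A = 1. Proof. by []. Qed.
Lemma fps_subE f g : fps_sub f g = f - g. Proof. by []. Qed.
Lemma fps_expE f k : fps_exp f k = f ^+ k.
Proof. by elim: k => [|k IH] //=; rewrite exprS -IH. Qed.

Lemma coef_fpsM f g n : (f * g) n = \sum_(i < n.+1) f i * g (n - i)%N.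
Proof. by []. Qed.
Lemma coef_fps1 n : (1 : fps A) n = (n == 0)%:R. Proof. by []. Qed.
Lemma coef_fpsD f g n : (f + g) n = f n + g n. Proof. by []. Qed.
Lemma coef_fpsN f n : (- f) n = - f n. Proof. by []. Qed.
Lemma coef_fps0 n : (0 : fps A) n = 0. Proof. by []. Qed.

End FpsRing.

(** * The Euler operator, logarithmic derivatives and formal powers *)

Section Theta.
Variables (K : numFieldType) (A : comAlgType K).
Implicit Types f g h s t : fps A.

Lemma mulrn_alg_eq0 (a : A) n : a *+ n.+1 = 0 -> a = 0.
Proof.
rewrite -(scaler_nat (n.+1)) => /(congr1 ( *:%R n.+1%:R^-1)).
by rewrite scalerA mulVf ?pnatr_eq0 // scale1r scaler0.
Qed.

Lemma coef_fpsMn f k n : (f *+ k) n = f n *+ k.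
Proof. by elim: k => // k IH; rewrite !mulrS coef_fpsD IH. Qed.

(* The Euler operator q d/dq. *)
Definition theta f : fps A := fun n => f n *+ n.

Lemma thetaD f g : theta (f + g) = theta f + theta g.
Proof. by apply/funext => n; rewrite /theta !coef_fpsD mulrnDl. Qed.

Lemma thetaN f : theta (- f) = - theta f.
Proof. by apply/funext => n; rewrite /theta !coef_fpsN mulNrn. Qed.

Lemma thetaB f g : theta (f - g) = theta f - theta g.
Proof. by rewrite thetaD thetaN. Qed.

Lemma theta1 : theta 1 = 0.
Proof.
by apply/funext => -[|n]; rewrite /theta coef_fps1 coef_fps0 ?mulr0n ?mul0rn.
Qed.

Lemma thetaM f g : theta (f * g) = theta f * g + f * theta g.
Proof.
apply/funext => n; rewrite coef_fpsD !coef_fpsM /theta coef_fpsM -sumrMnl -big_split.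
apply: eq_bigr => i _ /=.
by rewrite mulrnAl mulrnAr -mulrnDr subnKC // -ltnS.
Qed.

Lemma thetaX f k : theta (f ^+ k.+1) = (theta f * f ^+ k) *+ k.+1.
Proof.
elim: k => [|k IH]; first by rewrite expr1 expr0 mulr1.
by rewrite exprS thetaM IH mulrnAr mulrCA -exprS [RHS]mulrS.
Qed.

(** Since [s 0 = 0], the coefficient of q^m in [s * f] involves only earlier coefficients of [f], so
    the equation is a recursion once m is divided out. The bound [n] lets [s] and [t] agree only up
    to that order, as happens for partial products. *)
Lemma theta_agree s t f g n : s 0%N = 0 -> t 0%N = 0 -> f 0%N = g 0%N ->
  theta f = s * f -> theta g = t * g ->
  (forall m, (0 < m <= n)%N -> s m = t m) -> forall m, (m <= n)%N -> f m = g m.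
Proof.
move=> s0 t0 fg0 Ef Eg st; elim/ltn_ind => -[//|m] IH lt_mn.
apply/eqP; rewrite -subr_eq0; apply/eqP/(@mulrn_alg_eq0 _ m).
have Efm : f m.+1 *+ m.+1 = (s * f) m.+1 by rewrite -Ef.
have Egm : g m.+1 *+ m.+1 = (t * g) m.+1 by rewrite -Eg.
rewrite coef_fpsM big_ord_recl s0 mul0r add0r in Efm.
rewrite coef_fpsM big_ord_recl t0 mul0r add0r in Egm.
rewrite mulrnBl Efm Egm.
apply/eqP; rewrite subr_eq0; apply/eqP/eq_bigr => i _; have lt_im := ltn_ord i.
by rewrite lift0 subSS st ?IH //; lia.
Qed.

Lemma theta_inj s f g : s 0%N = 0 -> f 0%N = g 0%N ->
  theta f = s * f -> theta g = s * g -> f = g.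
Proof.
move=> s0 fg0 Ef Eg; apply/funext => n.
exact: (theta_agree s0 s0 fg0 Ef Eg (fun _ _ => erefl) (leqnn n)).
Qed.

Lemma coef_fpsX_lt g k n : g 0%N = 0 -> (n < k)%N -> (g ^+ k) n = 0.
Proof.
move=> g0; elim: k n => // k IH n lt_nk; rewrite exprS coef_fpsM big_ord_recl g0.
rewrite mul0r add0r big1 // => i _; rewrite IH ?mulr0 // lift0.
by have := ltn_ord i; lia.
Qed.

(** Powers of [g] beyond the n-th have no coefficient at n, so any cutoff [N > n] will do; a common
    cutoff lets finite sums be exchanged. *)
Lemma coef_fps_subst a g N n : g 0%N = 0 -> (n < N)%N ->
  fps_subst a g n = \sum_(k < N) a k *: (g ^+ k) n.
Proof.
move=> g0 lt_nN; rewrite /fps_subst.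
under eq_bigr do rewrite fps_expE.
rewrite -(big_mkord xpredT (fun k => a k *: (g ^+ k) n)).
rewrite -[in RHS](big_mkord xpredT (fun k => a k *: (g ^+ k) n)).
rewrite [RHS](big_cat_nat (n := n.+1)) //= [X in _ = _ + X]big_nat_cond.
rewrite [X in _ = _ + X]big1 ?addr0 // => k /andP[/andP[lt_nk _] _].
by rewrite coef_fpsX_lt // scaler0.
Qed.

Lemma coef_fps_mul_subst a g h N n : g 0%N = 0 -> (n < N)%N ->
  (h * fps_subst a g) n = \sum_(k < N) a k *: (h * g ^+ k) n.
Proof.
move=> g0 lt_nN; rewrite coef_fpsM.
under eq_bigr => i _.
  rewrite (coef_fps_subst a g0 (leq_ltn_trans (leq_subr i n) lt_nN)) mulr_sumr.
  over.
rewrite exchange_big; apply: eq_bigr => k _ /=.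
rewrite coef_fpsM scaler_sumr; apply: eq_bigr => i _.
by rewrite scalerAr.
Qed.

(** The chain rule, obtained termwise from [thetaX]. *)
Lemma theta_subst a g : g 0%N = 0 ->
  theta (fps_subst a g) = theta g * fps_subst (fun k => a k.+1 *+ k.+1) g.
Proof.
move=> g0; apply/funext => n.
rewrite (coef_fps_mul_subst _ _ g0 (ltnSn n)) -[LHS]/(fps_subst a g n *+ n).
rewrite (coef_fps_subst a g0 (ltnW (ltnSn n.+1))) -sumrMnl big_ord_recl.
(* The term k = 0 is a constant series, which [theta] kills. *)
rewrite [X in X + _](_ : _ = 0) ?add0r; last first.
  by case: (n) => [|m]; rewrite ?mulr0n // -[X in _ *: X]/(0 : A) scaler0 mul0rn.
apply: eq_bigr => k _; rewrite scalerMnr lift0 -[X in _ *: X = _]/(theta (g ^+ k.+1) n).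
by rewrite thetaX coef_fpsMn -scalerMnr scalerMnl.
Qed.

Lemma coef0_subst a g : fps_subst a g 0%N = (a 0%N)%:A.
Proof. by rewrite /fps_subst big_ord1 fps_expE expr0. Qed.

Lemma theta_exponential g : g 0%N = 0 ->
  theta (fps_exponential g) = theta g * fps_exponential g.
Proof.
move=> g0; rewrite theta_subst //; congr (_ * fps_subst _ _).
apply/funext => k; rewrite factS natrM invfM -(mulr_natl (_ * _)) mulrA mulfV ?mul1r //.
Qed.

Lemma coef0_exponential g : fps_exponential g 0%N = 1.
Proof. by rewrite /fps_exponential coef0_subst fact0 invr1 scale1r. Qed.

(** With f = 1 - g, the product of 1 - g and the geometric series telescopes, and the leftover
    g^(n+1) does not reach the coefficient n. *)
Lemma fps_mulV f : f 0%N = 1 -> f * fps_inv f = 1.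
Proof.
move=> f0; rewrite /fps_inv; set g : fps A := fps_sub _ _.
have g0 : g 0%N = 0 by rewrite /g /fps_sub f0 subrr.
have -> : f = 1 - g by rewrite /g fps_subE opprB addrC subrK.
apply/funext => n; rewrite (coef_fps_mul_subst _ _ g0 (ltnSn n)).
under eq_bigr do rewrite scale1r mulrBl mul1r -exprS coef_fpsD coef_fpsN.
rewrite -(big_mkord xpredT (fun k => (g ^+ k) n - (g ^+ k.+1) n)).
rewrite (telescope_sumr_eq (fun k => - (g ^+ k) n)) //; last first.
  by move=> k _; rewrite opprK addrC.
by rewrite coef_fpsX_lt // oppr0 add0r opprK expr0.
Qed.

Lemma fps_mulIf h f g : h 0%N = 1 -> h * f = h * g -> f = g.
Proof.
move=> h0 /(congr1 (fun u => fps_inv h * u)).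
by rewrite !mulrA ![fps_inv h * h]mulrC fps_mulV // !mul1r.
Qed.

(** The inverse rewritten in powers of f - 1, so that the termwise derivative of [fps_logarithm] can
    be recognised in it. *)
Lemma fps_inv_sign f : fps_inv f = fps_subst (fun k => (-1) ^+ k) (fps_sub f (fps_one A)).
Proof.
apply/funext => n; apply: eq_bigr => k _.
rewrite !fps_expE !fps_subE fps_oneE scale1r.
have -> : (1 - f) ^+ k = if odd k then - (f - 1) ^+ k else (f - 1) ^+ k.
  rewrite -(opprB f 1) exprNn -signr_odd.
  by case: (odd k); rewrite ?expr1 ?mulN1r ?expr0 ?mul1r.
rewrite -signr_odd; case: (odd k); last by rewrite scale1r.
by rewrite scaleN1r coef_fpsN.
Qed.

Lemma theta_logarithm f : f 0%N = 1 ->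
  theta (fps_logarithm f) = theta f * fps_inv f.
Proof.
move=> f0; have g0 : fps_sub f (fps_one A) 0%N = 0 by rewrite /fps_sub f0 subrr.
rewrite theta_subst // fps_inv_sign fps_subE fps_oneE thetaB theta1 subr0.
congr (_ * fps_subst _ _); apply/funext => k.
by rewrite -(mulr_natr (_ / _)) mulfVK ?pnatr_eq0 // !exprS !mulN1r opprK.
Qed.

Lemma coef0_logarithm f : fps_logarithm f 0%N = 0.
Proof. by rewrite /fps_logarithm coef0_subst invr0 mulr0 scale0r. Qed.

Lemma theta_scale (x : A) f : theta (fps_scale x f) = fps_scale x (theta f).
Proof. by apply/funext => n; rewrite /theta /fps_scale mulrnAr. Qed.

Lemma fps_scaleAl (x : A) f g : fps_scale x f * g = fps_scale x (f * g).
Proof.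
apply/funext => n; rewrite /fps_scale !coef_fpsM mulr_sumr.
by apply: eq_bigr => i _; rewrite mulrA.
Qed.

(** The exponent x log f has Euler derivative x (theta f) / f, that is x s. *)
Lemma theta_pow f s (x : A) : f 0%N = 1 -> theta f = s * f ->
  theta (fps_pow f x) = fps_scale x s * fps_pow f x.
Proof.
move=> f0 Ef; rewrite theta_exponential; last by rewrite /fps_scale coef0_logarithm mulr0.
by rewrite theta_scale theta_logarithm // Ef -mulrA fps_mulV // mulr1.
Qed.

End Theta.

(** * The formal overpartition product *)

(** The coefficient of q^m in 2n q^n/(1-q^(2n)) = 2n (q^n + q^(3n) + ...). *)
Definition odd_multiple (n m : nat) : nat :=
  if (n %| m)%N && odd (m %/ n) then n.*2 else 0.

Lemma odd_multiple_mul n k : (0 < n)%N ->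
  odd_multiple n (k * n) = if odd k then n.*2 else 0%N.
Proof. by move=> n0; rewrite /odd_multiple dvdn_mull // mulnK. Qed.

Lemma odd_multiple0 n : odd_multiple n 0 = 0%N.
Proof. by rewrite /odd_multiple div0n andbF. Qed.

(** Coefficient form of multiplication by 1 - q^(2n); the guard is the one in [coef_fpsXnM]. *)
Lemma odd_multiple_rec n m : (0 < n)%N ->
  odd_multiple n m = ((if n.*2 <= m then odd_multiple n (m - n.*2) else 0)
                      + (m == n) * n.*2)%N.
Proof.
move=> n0; case: (boolP (n %| m)%N) => [/dvdnP[k ->]|ndiv]; last first.
  rewrite {1}/odd_multiple (negbTE ndiv) /=.
  have -> : (m == n) = false by apply: contraNF ndiv => /eqP ->.
  case: ifP => // le2; rewrite /odd_multiple (dvdn_subl le2) ?(negbTE ndiv) //.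
  by rewrite -muln2 dvdn_mulr.
case: k => [|[|k]].
- by rewrite !mul0n odd_multiple0 leqn0 double_eq0 eqn0Ngt n0 /= eq_sym eqn0Ngt n0.
- rewrite odd_multiple_mul // mul1n eqxx mul1n.
  by have -> : (n.*2 <= n)%N = false by lia.
have -> : (k.+2 * n - n.*2 = k * n)%N by rewrite -mul2n -mulnBl !subSS subn0.
rewrite !odd_multiple_mul // -mul2n leq_mul2r orbT /= negbK.
have -> : (k.+2 * n == n)%N = false; last by rewrite addn0.
by rewrite -{2}[n]mul1n eqn_pmul2r.
Qed.

(** Write m = 2^a l with l odd. The divisors n of m with m/n odd are the 2^a d with d dividing l,
    and their doubles add up to 2^(a+1) sigma(l). *)
Lemma sum_odd_multiple N m : (0 < m <= N)%N ->
  (\sum_(1 <= n < N.+1) odd_multiple n m = sigmabar m)%N.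
Proof.
case/andP=> m0 le_mN.
set D := [seq n <- divisors m | odd (m %/ n)].
have -> : (\sum_(1 <= n < N.+1) odd_multiple n m = \sum_(n <- D) n.*2)%N.
  rewrite /odd_multiple -big_mkcond -big_filter; apply: perm_big.
  apply: uniq_perm; rewrite ?filter_uniq ?iota_uniq ?divisors_uniq // => n.
  rewrite !mem_filter mem_index_iota -dvdn_divisors //.
  case: (boolP (n %| m)%N) => [ndiv|]; last by rewrite andbF.
  rewrite !andbT /= [X in _ && X](_ : _ = true) ?andbT //.
  by have := dvdn_leq m0 ndiv; have := dvdn_gt0 m0 ndiv; lia.
set a := logn 2 m; set l := (m`_2^')%N.
have ml : (m = 2 ^ a * l)%N by rewrite -p_part partnC.
have l0 : (0 < l)%N by apply: part_gt0.
have oddl : odd l by rewrite odd_2'nat part_pnat.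
have -> : (\sum_(n <- D) n.*2 = \sum_(n <- [seq 2 ^ a * d | d <- divisors l]) n.*2)%N.
  apply: perm_big; apply: uniq_perm; rewrite ?filter_uniq ?divisors_uniq //.
    rewrite map_inj_uniq ?divisors_uniq // => x y /eqP.
    by rewrite eqn_pmul2l ?expn_gt0 // => /eqP.
  move=> n; rewrite mem_filter -dvdn_divisors //; apply/andP/mapP; last first.
    move=> [d]; rewrite -dvdn_divisors // => dl ->.
    rewrite ml divnMl ?expn_gt0 // dvdn_pmul2l ?expn_gt0 // dl; split=> //.
    by move: oddl; rewrite -{1}(divnK dl) oddM => /andP[].
  move=> [oddk nm]; have n0 := dvdn_gt0 m0 nm.
  (* As m/n is odd, n carries the whole power 2^a, so d must be the odd part of n. *)
  exists (n`_2^')%N; first by rewrite -dvdn_divisors // partn_dvd.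
  rewrite -{1}(partnC 2%N n0) p_part; congr (2 ^ _ * _)%N.
  have k0 : (0 < m %/ n)%N by rewrite divn_gt0 // dvdn_leq.
  have k2 : logn 2 (m %/ n) = 0%N by apply: logn_coprime; rewrite coprime2n.
  by rewrite /a -[in RHS](divnK nm) lognM ?k2.
rewrite big_map /sigmabar -/a -/l /sigma expnS big_distrr /=.
by apply: eq_bigr => d _; rewrite -mul2n mulnA.
Qed.

Lemma sum_odd_multiple_le N m : (0 < m)%N ->
  (\sum_(1 <= n < N.+1) odd_multiple n m <= sigmabar m)%N.
Proof.
move=> m0; rewrite -(@sum_odd_multiple (maxn N m)) ?m0 ?leq_maxr //.
by rewrite [leqRHS](@big_cat_nat _ _ _ N.+1) //= ?leq_addr // ltnS leq_maxl.
Qed.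

(** There are m terms, each at most 2m. This crude quadratic growth suffices for absolute
    convergence inside the unit disc. *)
Lemma sigmabar_le m : (0 < m)%N -> (sigmabar m <= (m * m).*2)%N.
Proof.
move=> m0; rewrite -(@sum_odd_multiple m) ?m0 ?leqnn //.
apply: (@leq_trans (\sum_(1 <= n < m.+1) m.*2)).
  rewrite !big_nat; apply: leq_sum => n /andP[_ le_nm].
  by rewrite /odd_multiple; case: ifP => // _; lia.
by rewrite sum_nat_const_nat subSS subn0; lia.
Qed.

Section Overpartitions.
Variables (K : numFieldType) (A : comAlgType K).
Implicit Types f g : fps A.
Local Notation Xn := (@fps_Xn K A).

Lemma coef_fpsXnM j f m : (Xn j * f) m = if (j <= m)%N then f (m - j)%N else 0.
Proof.
rewrite coef_fpsM; case: leqP => [le_jm|lt_mj].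
  rewrite (bigD1 (Ordinal (le_jm : (j < m.+1)%N))) //= /fps_Xn eqxx mul1r.
  rewrite big1 ?addr0 // => i /eqP ne_ij.
  by rewrite (_ : (i == j :> nat) = false) ?mul0r //; apply/eqP => E; apply/ne_ij/val_inj.
rewrite big1 // => i _; rewrite /fps_Xn (_ : (i == j :> nat) = false) ?mul0r //.
by apply/eqP => E; have := ltn_ord i; rewrite E; lia.
Qed.

Lemma fps_XnD i j : Xn (i + j) = Xn i * Xn j.
Proof.
apply/funext => m; rewrite coef_fpsXnM /fps_Xn.
by case: leqP => [le_im|lt_mi]; [congr (_%:R); lia | rewrite ltn_eqF //; lia].
Qed.

Lemma theta_Xn n : theta (Xn n) = Xn n *+ n.
Proof.
apply/funext => m; rewrite coef_fpsMn /theta /fps_Xn.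
by case: eqVneq => [->|_] //; rewrite !mul0rn.
Qed.

Definition fps_overfactor n : fps A :=
  fps_mul (fps_add (fps_one A) (Xn n)) (fps_inv (fps_sub (fps_one A) (Xn n))).

Lemma coef0_1BXn n : (0 < n)%N -> (1 - Xn n : fps A) 0%N = 1.
Proof. by case: n => // n _; rewrite coef_fpsD coef_fpsN /fps_Xn subr0. Qed.

Lemma fps_overfactorE n : (0 < n)%N -> (1 - Xn n) * fps_overfactor n = 1 + Xn n.
Proof.
move=> n0; rewrite /fps_overfactor fps_mulE fps_addE fps_subE fps_oneE mulrCA.
by rewrite fps_mulV ?mulr1 // coef0_1BXn.
Qed.

Lemma coef0_overfactor n : (0 < n)%N -> fps_overfactor n 0%N = 1.
Proof.
move=> n0; have := congr1 (@^~ 0%N) (fps_overfactorE n0).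
rewrite coef_fpsM big_ord1 coef0_1BXn // mul1r subnn coef_fpsD => ->.
by case: n n0 => // n _; rewrite /fps_Xn addr0.
Qed.

Definition fps_odd_multiple n : fps A := fun m => (odd_multiple n m)%:R.

Lemma fps_odd_multipleE n : (0 < n)%N ->
  (1 - Xn (n + n)) * fps_odd_multiple n = Xn n *+ n.*2.
Proof.
move=> n0; rewrite mulrBl mul1r; apply/funext => m.
rewrite coef_fpsD coef_fpsN coef_fpsXnM coef_fpsMn /fps_Xn /fps_odd_multiple.
rewrite {1}odd_multiple_rec // natrD natrM mulr_natr addnn.
by case: leqP => _; rewrite ?subr0 ?add0r // addrC addKr.
Qed.

(* Logarithmic differentiation: q d/dq log ((1+q^n)/(1-q^n)) = 2n q^n / (1-q^2n). *)
Lemma theta_overfactor n : (0 < n)%N ->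
  theta (fps_overfactor n) = fps_odd_multiple n * fps_overfactor n.
Proof.
move=> n0; have n20 : (0 < n + n)%N by rewrite addn_gt0 n0.
apply: (fps_mulIf (coef0_1BXn n20)); rewrite mulrA fps_odd_multipleE //.
have Ef := fps_overfactorE n0; have := congr1 (@theta _ _) Ef.
rewrite thetaM thetaB thetaD theta1 theta_Xn fps_XnD sub0r add0r -addnn mulrnDr.
set f := fps_overfactor n in Ef *; set x := Xn n in Ef *; set y := x *+ n => Et.
have -> : (1 - x * x) * theta f = (1 + x) * ((1 - x) * theta f) by ring.
have -> : (1 - x) * theta f = y + y * f by rewrite -{1}Et; ring.
by rewrite mulrDr -{1}Ef /y; ring.
Qed.

Lemma fps_overprodS N :
  fps_overprod A N.+1 = fps_overprod A N * fps_overfactor N.+1.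
Proof. by rewrite /fps_overprod (@big_nat_recr (fps A) 1 *%R). Qed.

Definition fps_sum_odd_multiple N : fps A :=
  fun m => (\sum_(1 <= n < N.+1) odd_multiple n m)%:R.

Lemma coef0_overprod N : fps_overprod A N 0%N = 1.
Proof.
elim: N => [|N IH]; first by rewrite /fps_overprod big_geq.
by rewrite fps_overprodS coef_fpsM big_ord1 IH mul1r coef0_overfactor.
Qed.

Lemma theta_overprod N :
  theta (fps_overprod A N) = fps_sum_odd_multiple N * fps_overprod A N.
Proof.
elim: N => [|N IH].
  rewrite /fps_overprod big_geq // fps_oneE theta1 mulr1.
  by apply/funext => m; rewrite /fps_sum_odd_multiple big_geq.
rewrite fps_overprodS thetaM IH theta_overfactor //.
transitivity ((fps_sum_odd_multiple N + fps_odd_multiple N.+1) *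
  (fps_overprod A N * fps_overfactor N.+1)); first by ring.
congr (_ * _); apply/funext => m.
by rewrite coef_fpsD /fps_sum_odd_multiple [in RHS]big_nat_recr //= natrD.
Qed.

(* The value of sigmabar at 0 is junk. *)
Definition fps_sigmabar : fps A := fun m => if m is 0%N then 0 else (sigmabar m)%:R.

Lemma coef0_sum_odd_multiple N : fps_sum_odd_multiple N 0%N = 0.
Proof. by rewrite /fps_sum_odd_multiple big1 // => n _; rewrite odd_multiple0. Qed.

Lemma coef_sum_odd_multiple N m : (m <= N)%N ->
  fps_sum_odd_multiple N m = fps_sigmabar m.
Proof.
case: m => [_|m le_mN]; first exact: coef0_sum_odd_multiple.
by rewrite /fps_sum_odd_multiple sum_odd_multiple.
Qed.

Definition fps_overprod_lim : fps A := fun n => fps_overprod A n n.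

(** Factors beyond the n-th leave the logarithmic derivative unchanged up to order n, hence also the
    product, so the diagonal records stable coefficients. *)
Lemma coef_overprod N n : (n <= N)%N -> fps_overprod A N n = fps_overprod_lim n.
Proof.
move=> le_nN; apply: (theta_agree (coef0_sum_odd_multiple N)
  (coef0_sum_odd_multiple n) _ (theta_overprod N) (theta_overprod n) _ (leqnn n)).
  by rewrite !coef0_overprod.
by move=> m /andP[_ le_mn]; rewrite !coef_sum_odd_multiple // (leq_trans le_mn).
Qed.

Lemma fps_cvg_overprod : fps_cvg (@fps_overprod K A) fps_overprod_lim.
Proof. by move=> n; exists n => N; exact: coef_overprod. Qed.

(** The coefficient n of the equation involves only indices up to n, where the limit may be replaced
    by the n-th partial product. *)
Lemma theta_overprod_lim : theta fps_overprod_lim = fps_sigmabar * fps_overprod_lim.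
Proof.
apply/funext => n; rewrite -[LHS]/(theta (fps_overprod A n) n) theta_overprod.
rewrite !coef_fpsM; apply: eq_bigr => i _.
by rewrite coef_sum_odd_multiple ?coef_overprod ?leq_subr // -ltnS.
Qed.

End Overpartitions.

(** * The generating series of [Pbar] and its derivative in x *)

Section PbarSeries.
Variable K : numFieldType.
Local Notation P := (@Pbar K : fps {poly K}).
Local Notation S := (@fps_sigmabar K {poly K}).

Lemma theta_Pbar : theta P = fps_scale 'X S * P.
Proof.
apply/funext => -[|n]; first by rewrite coef_fpsM big_ord1 /fps_scale mulr0 mul0r.
rewrite /theta Pbar_rec // scalerMnl -(mulr_natr n.+1%:R^-1) mulVf ?pnatr_eq0 // scale1r.
rewrite fps_scaleAl /fps_scale coef_fpsM big_ord_recl mul0r add0r; congr (_ * _).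
rewrite big_add1 /= big_mkord; apply: eq_bigr => i _.
by rewrite /bump leq0n add1n scaler_nat mulr_natl.
Qed.

(** Both series have constant term 1 and logarithmic derivative x S, so [theta_inj] identifies
    them. *)
Lemma Pbar_pow n : P n = fps_pow (fps_overprod_lim {poly K}) 'X n.
Proof.
suff -> : P = fps_pow (fps_overprod_lim {poly K}) 'X by [].
apply: (@theta_inj _ _ (fps_scale 'X S)); rewrite ?theta_Pbar //.
- by rewrite /fps_scale mulr0.
- by rewrite /fps_pow coef0_exponential.
by apply: theta_pow; [exact: coef0_overprod | exact: theta_overprod_lim].
Qed.

(** The formal logarithm of the product: its constant term is 0 because [0^-1 = 0], and [theta]
    sends it to [S]. *)
Definition fps_sigmabar_div : fps {poly K} :=
  fun k => ((sigmabar k)%:R / k%:R : K)%:A.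

Lemma theta_sigmabar_div : theta fps_sigmabar_div = S.
Proof.
apply/funext => -[//|k]; rewrite /theta /fps_sigmabar_div.
by rewrite scalerMnl -(mulr_natr (_ / _)) mulfVK ?pnatr_eq0 // scaler_nat.
Qed.

(* Both sides solve theta f = S P + 'X S f with the same constant term. *)
Lemma deriv_Pbar_series : (fun n => (Pbar K n)^`()) = fps_sigmabar_div * P :> fps {poly K}.
Proof.
set D : fps {poly K} := fun n => _.
(* [theta] commutes with d/dx, so this is [theta_Pbar] differentiated in x; the coefficients of [S]
   are constant polynomials. *)
have thetaD' : theta D = S * P + fps_scale 'X S * D.
  apply/funext => n; rewrite coef_fpsD !fps_scaleAl /fps_scale !coef_fpsM.
  rewrite /theta /D -derivMn -[_ *+ n]/(theta P n) theta_Pbar fps_scaleAl /fps_scale.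
  rewrite coef_fpsM derivM derivX mul1r raddf_sum; congr (_ + _ * _).
  apply: eq_bigr => i _; rewrite /= derivM -[RHS]add0r; congr (_ + _).
  by case: (nat_of_ord i) => [|m] /=; rewrite ?deriv0 -?polyC_natr ?derivC mul0r.
have : D - fps_sigmabar_div * P = 0; last by move=> /eqP; rewrite subr_eq0 => /eqP.
(* The difference solves the homogeneous equation theta f = x S f, as does 0. *)
apply: (@theta_inj _ _ (fps_scale 'X S)).
- by rewrite /fps_scale mulr0.
- rewrite coef_fpsD coef_fpsN coef_fpsM big_ord1 /fps_sigmabar_div invr0 mulr0.
  by rewrite scale0r mul0r subr0 /D Pbar0 derivC.
- rewrite thetaB thetaM theta_sigmabar_div theta_Pbar thetaD'; ring.
by rewrite mulr0; apply/funext => n; rewrite /theta mul0rn.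
Qed.

Lemma deriv_Pbar n : (0 < n)%N ->
  (Pbar K n)^`() = \sum_(1 <= k < n.+1) ((sigmabar k)%:R / k%:R) *: Pbar K (n - k).
Proof.
move=> n0; have := congr1 (@^~ n) deriv_Pbar_series => /= ->.
rewrite coef_fpsM big_ord_recl {1}/fps_sigmabar_div invr0 mulr0 scale0r mul0r add0r.
rewrite big_add1 /= big_mkord; apply: eq_bigr => i _.
by rewrite /fps_sigmabar_div /bump leq0n add1n mulr_algl.
Qed.

End PbarSeries.

(** * Limits and the exponential in the complex plane *)

Section ComplexLimits.
Variable R : realType.
Local Notation C := (R[i]^o).
Local Notation normc := (@Normc.normc R).
Implicit Types z w : R[i].

Lemma normcE z : `|z| = (normc z)%:C. Proof. by case: z. Qed.

Lemma normc_ge0 z : 0 <= normc z.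
Proof. by case: z => a b; exact: sqrtr_ge0. Qed.

Lemma normcD z w : normc (z + w) <= normc z + normc w.
Proof. exact: le_normcD. Qed.

Lemma normcB z w : normc (z - w) = normc (w - z).
Proof. by rewrite -opprB normcN. Qed.

Lemma normc_real (x : R) : normc x%:C = `|x|.
Proof. by rewrite /= expr0n /= addr0 sqrtr_sqr. Qed.

Lemma normc_nat n : normc n%:R = n%:R.
Proof. by rewrite -(rmorph_nat (real_complex R)) normc_real normr_nat. Qed.

Lemma normcX z n : normc (z ^+ n) = normc z ^+ n.
Proof.
elim: n => [|n IH]; first by rewrite !expr0 Normc.normc1.
by rewrite !exprS Normc.normcM IH.
Qed.

Lemma normc_sum I (r : seq I) (P : pred I) (F : I -> R[i]) :
  normc (\sum_(i <- r | P i) F i) <= \sum_(i <- r | P i) normc (F i).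
Proof.
elim/big_rec2 : _ => [|i x y _ le_yx]; first by rewrite Normc.normc0.
by rewrite (le_trans (normcD _ _)) // lerD2l.
Qed.

Lemma normr_Re_le z : `|complex.Re z| <= normc z.
Proof. by rewrite -lecR -normcE; exact: normc_ge_Re. Qed.

Lemma normr_Im_le z : `|complex.Im z| <= normc z.
Proof.
case: z => a b /=; rewrite -sqrtr_sqr ler_wsqrtr // lerDr sqr_ge0 //.
Qed.

Lemma normc_le z : normc z <= `|complex.Re z| + `|complex.Im z|.
Proof.
case: z => a b; rewrite -[X in normc X](_ : a%:C + (0 +i* b) = _); last first.
  by rewrite /= /real_complex_def; simpc.
apply: le_trans (normcD _ _) _; rewrite normc_real lerD2l /=.
by rewrite expr0n add0r sqrtr_sqr.
Qed.

Section Filters.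
Context {T : Type} {F : set_system T} {FF : Filter F}.
Implicit Types (f : T -> C) (l : C).

Lemma cvgCP f l :
  f x @[x --> F] --> l <-> normc (f x - l) @[x --> F] --> (0 : R).
Proof.
split=> [/cvgrPdist_lt H|/cvgr0Pnorm_lt H].
  apply/cvgr0Pnorm_lt => e e0; have e0' : 0 < e%:C by rewrite ltcR.
  have := H _ e0'; apply: filterS => x.
  by rewrite (ger0_norm (normc_ge0 _)) normcB normcE ltcR.
(* A positive element of [R[i]] is real, so a complex epsilon is the image of a real one. *)
apply/cvgrPdist_lt => e e0; have eE : (complex.Re e)%:C = e.
  by rewrite RRe_real // realE ltW.
have e0' : 0 < complex.Re e by rewrite -ltcR eE.
have := H _ e0'; apply: filterS => x.
by rewrite (ger0_norm (normc_ge0 _)) normcB normcE -eE ltcR.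
Qed.

Lemma cvgC_squeeze f l (v : T -> R) : (\forall x \near F, normc (f x - l) <= v x) ->
  v x @[x --> F] --> (0 : R) -> f x @[x --> F] --> l.
Proof.
move=> fv v0; apply/cvgCP; apply: squeeze_cvgr (cvg_cst 0) v0.
by apply: filterS fv => x fv; rewrite normc_ge0.
Qed.

Lemma cvg_Re f l : f x @[x --> F] --> l ->
  complex.Re (f x) @[x --> F] --> (complex.Re l : R).
Proof.
move=> /cvgCP fl; apply/cvgrPdist_lt => e e0.
move/cvgr0Pnorm_lt: fl => /(_ _ e0); apply: filterS => x.
rewrite (ger0_norm (normc_ge0 _)); apply: le_lt_trans; rewrite normcB.
by rewrite (_ : _ - _ = complex.Re (l - f x)) ?normr_Re_le // raddfB.
Qed.

Lemma cvg_Im f l : f x @[x --> F] --> l ->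
  complex.Im (f x) @[x --> F] --> (complex.Im l : R).
Proof.
move=> /cvgCP fl; apply/cvgrPdist_lt => e e0.
move/cvgr0Pnorm_lt: fl => /(_ _ e0); apply: filterS => x.
rewrite (ger0_norm (normc_ge0 _)); apply: le_lt_trans; rewrite normcB.
by rewrite (_ : _ - _ = complex.Im (l - f x)) ?normr_Im_le // raddfB.
Qed.

Lemma cvg_ReIm f l : complex.Re (f x) @[x --> F] --> (complex.Re l : R) ->
  complex.Im (f x) @[x --> F] --> (complex.Im l : R) -> f x @[x --> F] --> l.
Proof.
move=> /cvgrPdist_lt fr /cvgrPdist_lt fi; apply/cvgCP/cvgr0Pnorm_lt => e e0.
have e20 : 0 < e / 2 by rewrite divr_gt0.
apply: filterS (filterI (fr _ e20) (fi _ e20)) => x [hr hi].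
rewrite (ger0_norm (normc_ge0 _)) normcB; apply: le_lt_trans (normc_le _) _.
by rewrite !raddfB /= [e]splitr ltrD.
Qed.

Lemma cvg_cexp f l : f x @[x --> F] --> l -> cexp (f x) @[x --> F] --> (cexp l : C).
Proof.
move=> fl; have fr := cvg_Re fl; have fi := cvg_Im fl.
have cexpE z : cexp z = (expR (complex.Re z) * cos (complex.Im z))
                     +i* (expR (complex.Re z) * sin (complex.Im z)) by case: z.
have er := continuous_cvg FF (@continuous_expR R _) fr.
have ec := continuous_cvg FF (@continuous_cos R _) fi.
have es := continuous_cvg FF (@continuous_sin R _) fi.
by apply: cvg_ReIm; rewrite ?cexpE /=; under eq_fun do rewrite cexpE /=; exact: cvgM.
Qed.

End Filters.

Lemma normc_lim_le (u : nat -> C) (l : C) (b : R) :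
  (forall n, normc (u n) <= b) -> u @ \oo --> l -> normc l <= b.
Proof.
move=> ub ul; apply/ler_addgt0Pr => e e0.
have /cvgCP/cvgr0Pnorm_lt/(_ _ e0) := ul.
case=> N _ /(_ N (leqnn N)); rewrite /= ger0_norm ?normc_ge0 // normcB => le_e.
rewrite -[l](subrK (u N)) (le_trans (normcD _ _)) // addrC lerD //.
exact: ltW.
Qed.

(** Real and imaginary parts are real series dominated by the moduli, hence absolutely
    convergent. *)
Lemma cvg_series_normc (u : nat -> C) (B : R) :
  (forall n, \sum_(i < n) normc (u i) <= B) -> exists l : C, series u @ \oo --> l.
Proof.
move=> uB.
have H (v : nat -> R) : (forall i, `|v i| <= normc (u i)) -> cvgn (series v).
  move=> vu; apply: normed_cvg; apply: nondecreasing_is_cvgn.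
    by apply/nondecreasing_seqP => n; rewrite [leRHS]seriesSr lerDl; exact: normr_ge0.
  exists B => _ [n _ <-]; apply: le_trans (uB n).
  by rewrite /= /series /= big_mkord; exact: ler_sum.
have cr := H _ (fun i => normr_Re_le (u i)); have ci := H _ (fun i => normr_Im_le (u i)).
exists (limn (series (fun i => complex.Re (u i))) +i*
        limn (series (fun i => complex.Im (u i)))).
have sE n : series u n = series (fun i => complex.Re (u i)) n +i*
    series (fun i => complex.Im (u i)) n.
  elim: n => [|n IH]; first by rewrite /series /= !big_nil.
  by rewrite !seriesSr IH; case: (u n).
have -> : series u = fun n => series (fun i => complex.Re (u i)) n +i*
    series (fun i => complex.Im (u i)) n by apply/funext.
exact: cvg_ReIm.
Qed.

Lemma cexpD (z w : C) : cexp (z + w) = cexp z * cexp w.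
Proof.
case: z => a b; case: w => c d.
rewrite -[X in cexp X]/((a + c) +i* (b + d)) /= expRD cosD sinD.
apply/eqP; rewrite eq_complex /=; apply/andP; split; apply/eqP; ring.
Qed.

Lemma cexp0 : cexp 0 = 1 :> C.
Proof. by rewrite /= expR0 cos0 sin0 mulr1 mulr0. Qed.

Lemma cexp_neq0 (z : C) : cexp z != 0.
Proof.
apply/eqP => ez; have := cexpD z (- z); rewrite subrr cexp0 ez mul0r.
by move/eqP; rewrite oner_eq0.
Qed.

Lemma cexp_sum I (r : seq I) (F : I -> C) :
  cexp (\sum_(i <- r) F i) = \prod_(i <- r) cexp (F i).
Proof.
elim/big_rec2 : _ => [|i x y _ <-]; first exact: cexp0.
by rewrite cexpD.
Qed.

End ComplexLimits.

(** * Coefficientwise majorants of polynomials *)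

Section Domination.
Variable R : realType.
Local Notation normc := (@Normc.normc R).
Implicit Types (p q : {poly R[i]}) (a b : {poly R}).

(** Majorization passes to products and powers, so an estimate for complex coefficients reduces to
    the same one for their moduli. *)
Definition poly_dom p a := forall i, normc p`_i <= a`_i.

Lemma poly_domM p q a b : poly_dom p a -> poly_dom q b -> poly_dom (p * q) (a * b).
Proof.
move=> pa qb i; rewrite !coefM (le_trans (normc_sum _ _ _)) //.
by apply: ler_sum => j _; rewrite Normc.normcM ler_pM ?normc_ge0.
Qed.

Lemma poly_dom1 : poly_dom 1 1.
Proof. by move=> i; rewrite !coef1 normc_nat. Qed.

Lemma poly_domX p a n : poly_dom p a -> poly_dom (p ^+ n) (a ^+ n).
Proof.
move=> pa; elim: n => [|n IH]; first exact: poly_dom1.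
by rewrite !exprS; exact: poly_domM.
Qed.

Lemma horner1 (K : comNzRingType) (p : {poly K}) n : (size p <= n)%N ->
  p.[1] = \sum_(i < n) p`_i.
Proof.
by move=> le_pn; rewrite (horner_coef_wide _ le_pn); apply: eq_bigr => i _;
  rewrite expr1n mulr1.
Qed.

Lemma horner1_tail (K : comNzRingType) (p : {poly K}) n N :
  (n <= N)%N -> (size p <= N)%N ->
  p.[1] - \sum_(i < n) p`_i = \sum_(n <= i < N) p`_i.
Proof.
move=> le_nN le_pN; rewrite (horner1 le_pN) -!(big_mkord xpredT (fun i => p`_i)).
by rewrite [X in X - _](big_cat_nat (n := n)) //= addrAC subrr add0r.
Qed.

(** Each side is the sum of the coefficients from n on, so the triangle inequality applies. *)
Lemma poly_dom_tail p a n : poly_dom p a ->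
  normc (p.[1] - \sum_(i < n) p`_i) <= a.[1] - \sum_(i < n) a`_i.
Proof.
move=> pa; pose N := maxn n (maxn (size p) (size a)).
rewrite !(@horner1_tail _ _ n N) /N ?leq_max ?leqnn ?orbT //.
by apply: le_trans (normc_sum _ _ _) _; exact: ler_sum.
Qed.

End Domination.

(** * Partial sums of the exponential series and their complex limit *)

Definition exp_sum (K : fieldType) (n : nat) (z : K) : K :=
  \sum_(k < n) (k`!)%:R^-1 * z ^+ k.

Section ExpSum.
Variable R : realType.
Local Notation C := (R[i]^o).
Local Notation normc := (@Normc.normc R).
Implicit Types (x y : R) (z w : R[i]).

Lemma series_exp_coeff x n : series (exp_coeff x) n = exp_sum n x.
Proof.
by rewrite /series /= big_mkord; apply: eq_bigr => k _; rewrite /exp_coeff /= mulrC.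
Qed.

Lemma cvg_exp_sum x : exp_sum n x @[n --> \oo] --> expR x.
Proof.
rewrite (_ : (fun n => exp_sum n x) = series (exp_coeff x)); last first.
  by apply/funext => n; rewrite series_exp_coeff.
exact: is_cvg_series_exp_coeff.
Qed.

Lemma exp_sum_le x n : 0 <= x -> exp_sum n x <= expR x.
Proof.
move=> x0; rewrite -series_exp_coeff.
apply: (nondecreasing_cvgn_le _ (is_cvg_series_exp_coeff x)).
apply/nondecreasing_seqP => k; rewrite [leRHS]series_exp_coeff series_exp_coeff.
rewrite /exp_sum big_ord_recr /= lerDl mulr_ge0 ?exprn_ge0 //.
Qed.

(** Factor out z - w: the cofactor has k terms of modulus at most r^(k-1). *)
Lemma normc_exprB_le z w r k : normc z <= r -> normc w <= r ->
  normc (z ^+ k - w ^+ k) <= k%:R * r ^+ k.-1 * normc (z - w).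
Proof.
move=> zr wr; have r0 : 0 <= r by rewrite (le_trans (normc_ge0 z)).
case: k => [|k]; first by rewrite !expr0 subrr Normc.normc0 !mul0r.
rewrite subrXX Normc.normcM mulrC ler_wpM2r ?normc_ge0 //.
apply: le_trans (normc_sum _ _ _) _.
apply: (@le_trans _ _ (\sum_(i < k.+1) r ^+ k)).
  apply: ler_sum => i _; rewrite Normc.normcM !normcX.
  have -> : r ^+ k = r ^+ (k - i) * r ^+ i by rewrite -exprD subnK // -ltnS.
  by rewrite ler_pM ?exprn_ge0 ?normc_ge0 // lerXn2r // nnegrE normc_ge0.
by rewrite sumr_const card_ord mulr_natl.
Qed.

(** Since k/k! = 1/(k-1)!, the termwise Lipschitz constants add up to a partial sum for e^r; the
    bound is uniform in n. *)
Lemma normc_exp_sumB_le n z w r : normc z <= r -> normc w <= r ->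
  normc (exp_sum n z - exp_sum n w) <= expR r * normc (z - w).
Proof.
move=> zr wr; have r0 : 0 <= r by rewrite (le_trans (normc_ge0 z)).
case: n => [|n].
  by rewrite /exp_sum !big_ord0 subrr Normc.normc0 mulr_ge0 ?expR_ge0 ?normc_ge0.
apply: (@le_trans _ _ (exp_sum n r * normc (z - w))); last first.
  by rewrite ler_wpM2r ?normc_ge0 // exp_sum_le.
rewrite /exp_sum -sumrB; apply: le_trans (normc_sum _ _ _) _.
rewrite big_ord_recl !expr0 subrr Normc.normc0 add0r mulr_suml.
apply: ler_sum => i _; rewrite lift0 -mulrBr Normc.normcM Normc.normcV normc_nat.
apply: le_trans (ler_wpM2l _ (normc_exprB_le _ zr wr)) _; first by rewrite invr_ge0.
rewrite mulrA ler_wpM2r ?normc_ge0 // mulrA ler_wpM2r ?exprn_ge0 //.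
by rewrite factS natrM invfM mulrAC mulVf ?mul1r // pnatr_eq0.
Qed.

(** A formal variable records the degree in z; setting it to 1 gives back [exp_sum n z]. *)
Definition exp_poly (K : fieldType) (n : nat) (z : K) : {poly K} :=
  \poly_(k < n) ((k`!)%:R^-1 * z ^+ k).

Lemma horner_exp_poly (K : fieldType) n (z : K) : (exp_poly n z).[1] = exp_sum n z.
Proof.
rewrite (horner1 (size_poly _ _)); apply: eq_bigr => i _.
by rewrite coef_poly ltn_ord.
Qed.

(** The binomial theorem; below degree n the truncation does not affect the product. *)
Lemma coef_exp_polyM (K : numFieldType) n (z w : K) m : (m < n)%N ->
  (exp_poly n z * exp_poly n w)`_m = (m`!)%:R^-1 * (z + w) ^+ m.
Proof.
move=> lt_mn; rewrite exprDn coefMr mulr_sumr; apply: eq_bigr => i _.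
have le_im : (i <= m)%N by rewrite -ltnS.
rewrite !coef_poly !ifT; [|lia..].
rewrite -mulr_natl -(bin_fact le_im) !natrM.
have nz k : (k`!)%:R != 0 :> K by rewrite pnatr_eq0 -lt0n fact_gt0.
have nzb : ('C(m, i))%:R != 0 :> K by rewrite pnatr_eq0 -lt0n bin_gt0.
by field; rewrite !nz nzb.
Qed.

Lemma poly_dom_exp n z : poly_dom (exp_poly n z) (exp_poly n (normc z)).
Proof.
move=> i; rewrite !coef_poly; case: ifP => _; last by rewrite Normc.normc0.
by rewrite Normc.normcM Normc.normcV normc_nat normcX.
Qed.

(** The first n coefficients of the product of exponential polynomials add up to
    [exp_sum n (z + w)], so the difference is a tail at 1, majorized by the same tail for the
    moduli. *)
Lemma normc_exp_sumD n z w :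
  normc (exp_sum n z * exp_sum n w - exp_sum n (z + w)) <=
  exp_sum n (normc z) * exp_sum n (normc w) - exp_sum n (normc z + normc w).
Proof.
have := poly_dom_tail n (poly_domM (poly_dom_exp n z) (poly_dom_exp n w)).
rewrite !hornerM !horner_exp_poly.
by under eq_bigr do rewrite coef_exp_polyM //; under [X in _ <= _ - X]eq_bigr do
  rewrite coef_exp_polyM //.
Qed.

Lemma exp_sum_real n x : exp_sum n x%:C = (exp_sum n x)%:C.
Proof.
rewrite /exp_sum rmorph_sum; apply: eq_bigr => k _.
by rewrite rmorphM rmorphXn fmorphV rmorph_nat.
Qed.

(** Both parities in one formula, shaped to match [cos_coeff] and [sin_coeff]. *)
Lemma expr_imag x k : (0 +i* x : R[i]) ^+ k =
  ((~~ odd k)%:R * (-1) ^+ k./2 * x ^+ k) +i* ((odd k)%:R * (-1) ^+ k.-1./2 * x ^+ k).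
Proof.
elim: k => [|k IH]; first by apply/eqP; rewrite eq_complex /= !mulr1 !eqxx.
rewrite exprS IH; apply/eqP; rewrite eq_complex /= !mul0r sub0r add0r !exprS negbK.
apply/andP; split; apply/eqP; last by ring.
case: k {IH} => [|k] /=; first by rewrite !mul0r mulr0 oppr0.
by rewrite (exprS (-1)); ring.
Qed.

Lemma exp_sum_imag n x : exp_sum n (0 +i* x : R[i]) =
  series (cos_coeff x) n +i* series (sin_coeff x) n.
Proof.
elim: n => [|n IH]; first by rewrite /exp_sum /series /= big_ord0 !big_nil.
rewrite /exp_sum big_ord_recr /= -/(exp_sum _ _) IH expr_imag.
rewrite !seriesSr -[in LHS](rmorph_nat (real_complex R)) -fmorphV.
rewrite /cos_coeff /sin_coeff /=.
apply/eqP; rewrite eq_complex /= !mul0r subr0 addr0.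
by apply/andP; split; apply/eqP; rewrite -?exprnP; ring.
Qed.

(** For real and for imaginary arguments the limits come from [expR], [cos] and [sin]. At a + ib,
    the sum differs from the product of two such sums by at most the bound of [normc_exp_sumD],
    which tends to exp(|a|+|b|) minus itself. *)
Lemma cvg_exp_sumC (z : C) : exp_sum n z @[n --> \oo] --> (cexp z : C).
Proof.
case: z => a b; pose w : C := 0 +i* b.
have zE : a +i* b = a%:C + w by rewrite /w /real_complex_def; simpc.
have ea : exp_sum n a%:C @[n --> \oo] --> ((expR a)%:C : C).
  apply: cvg_ReIm; under eq_fun do rewrite exp_sum_real /=; last exact: cvg_cst.
  exact: cvg_exp_sum.
have ew : exp_sum n w @[n --> \oo] --> ((cos b +i* sin b) : C).
  have cb : series (cos_coeff b) @ \oo --> cos b.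
    by rewrite unlock; exact: is_cvg_series_cos_coeff.
  have sb : series (sin_coeff b) @ \oo --> sin b.
    by rewrite unlock; exact: is_cvg_series_sin_coeff.
  by apply: cvg_ReIm; under eq_fun do rewrite exp_sum_imag /=.
have eaw : exp_sum n a%:C * exp_sum n w @[n --> \oo] --> (cexp (a +i* b) : C).
  rewrite (_ : cexp _ = (expR a)%:C * (cos b +i* sin b)); first exact: (cvgM ea ew).
  by rewrite /= /real_complex_def; simpc.
have d0 : (exp_sum n (a%:C + w) - exp_sum n a%:C * exp_sum n w) @[n --> \oo] --> (0 : C).
  apply: (@cvgC_squeeze _ _ _ _ _ _ (fun n => exp_sum n (normc a%:C) * exp_sum n (normc w)
     - exp_sum n (normc a%:C + normc w))).
    by apply: nearW => n; rewrite subr0 normcB normc_exp_sumD.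
  rewrite -(subrr (expR (normc a%:C + normc w))) {1}expRD.
  by apply: cvgB; [apply: cvgM|]; exact: cvg_exp_sum.
rewrite -[X in _ --> X]addr0.
rewrite (_ : (fun n => _) = (fun n => exp_sum n a%:C * exp_sum n w : C) +
  (fun n => exp_sum n (a%:C + w) - exp_sum n a%:C * exp_sum n w : C)).
  exact: (@cvgD _ C _ _ _ _ _ _ _ eaw d0).
by apply/funext => n; rewrite fctE /= addrC subrK zE.
Qed.

End ExpSum.

(** * Convergence of formal exponentials *)

Section ExpTrunc.
Variable K : numFieldType.
Implicit Types (g : fps K^o) (n m k : nat).

Definition ptrunc g n : {poly K} := \poly_(i < n.+1) g i.

Lemma coef_ptruncX g n k m : (m <= n)%N -> (ptrunc g n ^+ k)`_m = (g ^+ k) m.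
Proof.
elim: k m => [|k IH] m le_mn; first by rewrite expr0 coef1.
rewrite !exprS coefM coef_fpsM; apply: eq_bigr => i _.
have le_im : (i <= m)%N by rewrite -ltnS.
by rewrite IH ?(leq_trans (leq_subr _ _)) // coef_poly ltnS (leq_trans le_im).
Qed.

(** Both the exponential series and its argument are cut at n. For [g 0 = 0] the coefficients up to
    n are those of the full formal exponential, while the value at 1 is an exponential sum at a
    partial sum of [g]; the higher coefficients are the error. *)
Definition exp_trunc g n : {poly K} :=
  \sum_(k < n.+1) (k`!)%:R^-1 *: ptrunc g n ^+ k.

Lemma horner_ptrunc g n : (ptrunc g n).[1] = \sum_(i < n.+1) g i.
Proof.
rewrite (horner1 (size_poly _ _)); apply: eq_bigr => i _.
by rewrite coef_poly ltn_ord.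
Qed.

Lemma horner_exp_trunc g n :
  (exp_trunc g n).[1] = exp_sum n.+1 (\sum_(i < n.+1) g i : K).
Proof.
rewrite /exp_trunc horner_sum; apply: eq_bigr => k _.
by rewrite hornerZ horner_exp horner_ptrunc.
Qed.

Lemma coef_exp_trunc g n m : g 0%N = 0 -> (m <= n)%N ->
  (exp_trunc g n)`_m = fps_exponential g m.
Proof.
move=> g0 le_mn; rewrite /fps_exponential (coef_fps_subst _ g0 (le_mn : (m < n.+1)%N)).
rewrite /exp_trunc coef_sum; apply: eq_bigr => k _.
by rewrite coefZ coef_ptruncX.
Qed.

End ExpTrunc.

Section ExpTruncReal.
Variables (R : realType) (a : fps R^o).
Hypotheses (a_ge0 : forall n, 0 <= a n) (a0 : a 0%N = 0).

Lemma coef_ptruncX_le n k m : 0 <= (ptrunc a n ^+ k)`_m <= (a ^+ k) m.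
Proof.
elim: k m => [|k IH] m; first by rewrite expr0 coef1 ler0n lexx.
rewrite !exprS coefM coef_fpsM.
have p_ge0 i : 0 <= (ptrunc a n)`_i <= a i.
  by rewrite coef_poly; case: ifP; rewrite ?lexx ?a_ge0.
apply/andP; split.
  by apply: sumr_ge0 => i _; have /andP[? _] := p_ge0 i;
    have /andP[? _] := IH (m - i)%N; rewrite mulr_ge0.
apply: ler_sum => i _; have /andP[? ?] := p_ge0 i.
by have /andP[? ?] := IH (m - i)%N; rewrite ler_pM.
Qed.

Lemma coef_exp_trunc_le n m : 0 <= (exp_trunc a n)`_m <= fps_exponential a m.
Proof.
have inv_ge0 k : 0 <= (k`!)%:R^-1 :> R by rewrite invr_ge0 ler0n.
rewrite /fps_exponential (@coef_fps_subst _ _ _ _ (maxn n m).+1) ?ltnS ?leq_maxr //.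
rewrite -(big_mkord xpredT (fun k => (k`!)%:R^-1 *: (a ^+ k) m)).
rewrite (big_cat_nat (n := n.+1)) //= ?ltnS ?leq_maxl //.
rewrite /exp_trunc coef_sum.
apply/andP; split.
  apply: sumr_ge0 => k _; rewrite coefZ mulr_ge0 //.
  by have /andP[] := coef_ptruncX_le n k m.
rewrite -[leLHS]addr0 lerD //.
  rewrite big_mkord; apply: ler_sum => k _; rewrite coefZ ler_wpM2l //.
  by have /andP[] := coef_ptruncX_le n k m.
apply: sumr_ge0 => k _; apply: mulr_ge0 => //.
by have /andP[] := coef_ptruncX_le n k m; exact: le_trans.
Qed.

Lemma coef_exponential_ge0 m : 0 <= fps_exponential a m.
Proof. by have /andP[] := coef_exp_trunc_le m m; exact: le_trans. Qed.

(* Both sequences increase to the same limit: the truncation [exp_trunc a n] is a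
   polynomial with coefficients below those of the full exponential. *)
Lemma exp_trunc_tail_cvg0 B : (forall n, \sum_(i < n) a i <= B) ->
  (exp_trunc a n).[1] - \sum_(i < n.+1) (exp_trunc a n)`_i @[n --> \oo] --> (0 : R).
Proof.
move=> aB; pose E n := \sum_(i < n.+1) fps_exponential a i : R.
have EE n : \sum_(i < n.+1) (exp_trunc a n)`_i = E n.
  by apply: eq_bigr => i _; rewrite coef_exp_trunc // -ltnS.
under eq_fun do rewrite EE.
have E_le n : E n <= (exp_trunc a n).[1].
  rewrite -EE -subr_ge0 (@horner1_tail _ _ _ (maxn n.+1 (size (exp_trunc a n)))).
  - by apply: sumr_ge0 => i _; have /andP[] := coef_exp_trunc_le n i.
  - exact: leq_maxl.
  - exact: leq_maxr.
have U_le n : (exp_trunc a n).[1] <= expR B.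
  rewrite horner_exp_trunc (le_trans (exp_sum_le _ _)) ?sumr_ge0 // ler_expR.
  exact: aB.
have E_nd : nondecreasing_seq E.
  apply/nondecreasing_seqP => n; rewrite /E [leRHS]big_ord_recr /= lerDl.
  exact: coef_exponential_ge0.
have E_cvg : cvgn E.
  apply: nondecreasing_is_cvgn => //; exists (expR B) => _ [n _ <-].
  exact: le_trans (E_le n) (U_le n).
have U_lim n : (exp_trunc a n).[1] <= limn E.
  apply: le_trans (nondecreasing_cvgn_le E_nd E_cvg (size (exp_trunc a n))).
  rewrite (horner1 (leqnSn (size (exp_trunc a n)))).
  by apply: ler_sum => i _; have /andP[] := coef_exp_trunc_le n i.
rewrite -(subrr (limn E)); apply: cvgB => //.
apply: squeeze_cvgr E_cvg (cvg_cst _).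
by apply: nearW => n; rewrite E_le U_lim.
Qed.

End ExpTruncReal.

Section CvgExponential.
Variable R : realType.
Local Notation C := (R[i]^o).
Local Notation normc := (@Normc.normc R).

(** Three gaps are added: from the partial sum to [U n], a tail majorized by that of the moduli;
    from [U n] to the exponential sum at [G], the Lipschitz bound; from there to [cexp G],
    convergence of the exponential series. *)
Lemma cvg_series_exponential (g : fps C) (G : C) (B : R) : g 0%N = 0 ->
  (forall n, \sum_(i < n) normc (g i) <= B) -> series g @ \oo --> G ->
  series (fps_exponential g : nat -> C) @ \oo --> (cexp G : C).
Proof.
move=> g0 gB gG; pose a : fps R^o := fun n => normc (g n).
have a0 : a 0%N = 0 by rewrite /a g0 Normc.normc0.
have a_ge0 n : 0 <= a n by exact: normc_ge0.
have dom n : poly_dom (exp_trunc g n) (exp_trunc a n).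
  move=> i; rewrite /exp_trunc !coef_sum (le_trans (normc_sum _ _ _)) //.
  apply: ler_sum => k _; rewrite !coefZ Normc.normcM Normc.normcV normc_nat.
  rewrite ler_wpM2l ?invr_ge0 ?ler0n //; apply: poly_domX => j.
  by rewrite !coef_poly; case: ifP => // _; rewrite Normc.normc0.
have B0 : 0 <= B by have := gB 0%N; rewrite big_ord0.
have series_le n : normc (series g n) <= B.
  by rewrite /series /= big_mkord (le_trans (normc_sum _ _ _)).
have G_le : normc G <= B by exact: normc_lim_le series_le gG.
rewrite -(@cvg_shiftS C).
pose U n := exp_sum n.+1 (series g n.+1).
have UE n : U n = (exp_trunc g n).[1].
  by rewrite horner_exp_trunc /U /series /= big_mkord.
have b1 n : normc (series (fps_exponential g : nat -> C) n.+1 - U n) <=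
    (exp_trunc a n).[1] - \sum_(i < n.+1) (exp_trunc a n)`_i.
  rewrite normcB UE (_ : series _ _ = \sum_(i < n.+1) (exp_trunc g n)`_i).
    exact: poly_dom_tail.
  rewrite /series /= big_mkord; apply: eq_bigr => i _.
  by rewrite coef_exp_trunc // -ltnS.
have b2 n : normc (U n - exp_sum n.+1 G) <= expR B * normc (series g n.+1 - G).
  exact: normc_exp_sumB_le.
have c1 := exp_trunc_tail_cvg0 a_ge0 a0 gB.
have c2 : normc (series g n.+1 - G) @[n --> \oo] --> (0 : R).
  have : series g n.+1 @[n --> \oo] --> G by rewrite (@cvg_shiftS C).
  by move/cvgCP.
have c3 : normc (exp_sum n.+1 G - cexp G) @[n --> \oo] --> (0 : R).
  have := @cvg_exp_sumC R G; rewrite -(@cvg_shiftS C).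
  by move/cvgCP.
apply: (@cvgC_squeeze _ _ _ _ _ _ (fun n => ((exp_trunc a n).[1] -
    \sum_(i < n.+1) (exp_trunc a n)`_i) + expR B * normc (series g n.+1 - G) +
    normc (exp_sum n.+1 G - cexp G))).
  apply: nearW => n; set s := series _ n.+1.
  have -> : s - cexp G = (s - U n) + (U n - exp_sum n.+1 G) + (exp_sum n.+1 G - cexp G).
    by rewrite -!addrA !addKr.
  apply: (le_trans (normcD _ _)); rewrite lerD2r.
  by apply: (le_trans (normcD _ _)); apply: lerD; [exact: b1 | exact: b2].
rewrite -[X in _ --> X]addr0; apply: cvgD => //.
rewrite -[X in _ --> X]addr0; apply: cvgD => //.
rewrite -[X in _ --> X](mulr0 (expR B)); apply: cvgM => //.
exact: cvg_cst.
Qed.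

End CvgExponential.

(** * The infinite product on the unit disc *)

Section PowerSums.
Variables (R : realType) (r : R).
Hypotheses (r0 : 0 <= r) (r1 : r < 1).

(* Summation by parts: [(1 - r) \sum a_k r^k] is at most the sum of the
   differences of [a] weighted by [r^k]. *)
Lemma power_sum_bounded (a d : nat -> R) (B : R) : (forall k, 0 <= a k) ->
  d 0%N = a 0%N -> (forall k, d k.+1 = a k.+1 - a k) ->
  (forall n, \sum_(k < n) d k * r ^+ k <= B) ->
  forall n, \sum_(k < n) a k * r ^+ k <= B / (1 - r).
Proof.
move=> a_ge0 d0 dS dB [|n].
  have := dB 0%N; rewrite !big_ord0 => B0.
  by rewrite divr_ge0 // subr_ge0 ltW.
rewrite ler_pdivlMr ?subr_gt0 // (le_trans _ (dB n.+1)) //.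
have -> : \sum_(k < n.+1) d k * r ^+ k =
    (\sum_(k < n.+1) a k * r ^+ k) * (1 - r) + a n * r ^+ n.+1.
  elim: n => [|n IH]; first by rewrite !big_ord1 d0 expr0 expr1; ring.
  by rewrite big_ord_recr IH [in RHS]big_ord_recr /= dS !exprS; ring.
by rewrite lerDl mulr_ge0 ?exprn_ge0.
Qed.

(** Three summations by parts: 1, 0, 0, ... is the difference sequence of 1, which is that of k+1,
    and 2(k+1) is that of (k+1)(k+2), which exceeds (k+1)^2. *)
Lemma square_power_sum_bounded :
  exists B, forall n, \sum_(k < n) (k.+1 * k.+1)%:R * r ^+ k <= B.
Proof.
have b0 n : \sum_(k < n) (k == 0%N :> nat)%:R * r ^+ k <= 1.
  case: n => [|n]; first by rewrite big_ord0.
  by rewrite big_ord_recl mul1r expr0 big1 ?addr0 // => i _; rewrite mul0r.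
have b1 := @power_sum_bounded (fun=> 1) (fun k => (k == 0%N)%:R) _ (fun=> ler01) erefl
  (fun _ => esym (subrr 1)) b0.
have b2 n : \sum_(k < n) k.+1%:R * r ^+ k <= 1 / (1 - r) / (1 - r).
  apply: (@power_sum_bounded (fun k => k.+1%:R) (fun=> 1) _ _ _ _ b1) => // k.
  by rewrite -[in X in X - _]natr1 addrAC subrr add0r.
have b3 n : \sum_(k < n) (2 * k.+1%:R) * r ^+ k <= 2 * (1 / (1 - r) / (1 - r)).
  under eq_bigr do rewrite -mulrA.
  by rewrite -mulr_sumr ler_wpM2l // ?b2.
exists (2 * (1 / (1 - r) / (1 - r)) / (1 - r)) => n.
apply: le_trans (@power_sum_bounded (fun k => (k.+1 * k.+2)%:R) (fun k => 2 * k.+1%:R) _ _ _ _ b3 n).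
- apply: ler_sum => k _; rewrite ler_wpM2r ?exprn_ge0 // ler_nat.
  by rewrite leq_mul2l leqnSn orbT.
- by move=> k; exact: ler0n.
- by rewrite -natrM.
by move=> k; rewrite !natrM -!natr1; ring.
Qed.

End PowerSums.

(** * Logarithm series with coefficients of at most linear growth *)

Section LogSeries.
Variable R : realType.
Local Notation C := (R[i]^o).
Local Notation normc := (@Normc.normc R).
Implicit Types (h : nat -> nat) (q x : C).

(* The term m = 0 vanishes since 0^-1 = 0. *)
Definition log_term h q (m : nat) : C := (h m)%:R / m%:R * q ^+ m.

(** Met by each [odd_multiple n] and by [sigmabar_pos], so the same estimates serve single factors
    and the whole product. *)
Definition quadratic h := forall m, (0 < m)%N -> (h m <= (m * m).*2)%N.

Lemma normc_log_term h q m : normc (log_term h q m) = (h m)%:R / m%:R * normc q ^+ m.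
Proof. by rewrite !Normc.normcM Normc.normcV !normc_nat normcX. Qed.

Lemma log_term_bounded q : normc q < 1 -> exists B, forall h, quadratic h ->
  forall n, \sum_(i < n) normc (log_term h q i) <= B.
Proof.
move=> q1; have [B HB] := square_power_sum_bounded (normc_ge0 q) q1.
exists (2 * B) => h hq n; apply: le_trans (ler_wpM2l _ (HB n)) => //.
rewrite mulr_sumr; apply: ler_sum => -[[|m] /= lt_mn] _; rewrite normc_log_term.
  by rewrite invr0 mulr0 mul0r expr0 !mulr1.
rewrite mulrA ler_wpM2r ?exprn_ge0 ?normc_ge0 // ler_pdivrMr ?ltr0n //.
rewrite -!natrM ler_nat (leq_trans (hq _ _)) //; nia.
Qed.

Lemma cvg_log_series h q : quadratic h -> normc q < 1 ->
  series (log_term h q) @ \oo --> (limn (series (log_term h q)) : C).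
Proof.
move=> hq q1; have [B HB] := log_term_bounded q1.
by have [l hl] := cvg_series_normc (HB h hq); apply/cvgP: hl.
Qed.

(* Substituting q for the formal variable turns theta f = (x h) f into the same
   equation for the sequence f_n q^n, which is thus a formal exponential. *)
Lemma cvg_theta_series (f : fps C) h x q : quadratic h -> h 0%N = 0%N ->
  f 0%N = 1 -> theta f = fps_scale x (fun m => (h m)%:R) * f -> normc q < 1 ->
  series (fun n => f n * q ^+ n : C) @ \oo -->
    (cexp (x * limn (series (log_term h q))) : C).
Proof.
move=> hq h0 f0 Ef q1; pose g : fps C := fun n => x * log_term h q n.
have g0 : g 0%N = 0 by rewrite /g /log_term invr0 mulr0 mul0r mulr0.
have -> : (fun n => f n * q ^+ n : C) = fps_exponential g.
  apply: (@theta_inj R[i] C (theta g)); rewrite ?theta_exponential //.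
    by rewrite coef0_exponential f0 mul1r.
  apply/funext => n; rewrite coef_fpsM /theta -mulrnAl -[f n *+ n]/(theta f n) Ef.
  rewrite coef_fpsM mulr_suml; apply: eq_bigr => i _.
  have -> : q ^+ n = q ^+ i * q ^+ (n - i) by rewrite -exprD subnKC // -ltnS.
  rewrite mulrACA; congr (_ * _); rewrite /g /fps_scale /log_term.
  case: (nat_of_ord i) => [|m]; first by rewrite h0 mulr0 mul0r mulr0n.
  rewrite -[RHS](mulr_natr _ m.+1) -!mulrA [q ^+ _ * _]mulrC [in RHS](mulrA (m.+1%:R^-1)).
  by rewrite mulVf ?pnatr_eq0 // mul1r.
have [B HB] := log_term_bounded q1.
apply: (@cvg_series_exponential _ _ _ (normc x * B)) => //.
  move=> n; under eq_bigr do rewrite Normc.normcM.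
  by rewrite -mulr_sumr ler_wpM2l ?normc_ge0 ?HB.
have -> : series g = fun n => x * series (log_term h q) n.
  by apply/funext => n; rewrite /series /= mulr_sumr.
by apply: cvgM; [exact: cvg_cst | exact: cvg_log_series].
Qed.

End LogSeries.

(** * The overpartition product as an exponential *)

Section OverpartitionProduct.
Variable R : realType.
Local Notation C := (R[i]^o).
Local Notation normc := (@Normc.normc R).
Implicit Types (q x : C).

Lemma unit_discE q : unit_disc q <-> normc q < 1.
Proof. by rewrite /unit_disc /= normcE -[1]/(1%:C) ltcR. Qed.

Lemma quadratic_odd_multiple n : quadratic (odd_multiple n).
Proof.
move=> m m0; rewrite /odd_multiple; case: ifP => // /andP[/(dvdn_leq m0) le_nm _].
by nia.
Qed.

(** The default value of [sigmabar] at 0 is replaced by 0, because [cvg_theta_series] asks for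
    [h 0 = 0]. *)
Definition sigmabar_pos (m : nat) : nat := if m is 0%N then 0%N else sigmabar m.

Lemma quadratic_sigmabar : quadratic sigmabar_pos.
Proof. by case=> // m _; exact: sigmabar_le. Qed.

Definition log_overprod q : C := limn (series (log_term sigmabar_pos q)).
Definition log_factor (n : nat) q : C := limn (series (log_term (odd_multiple n) q)).

Lemma one_sub_expr_neq0 q n : (0 < n)%N -> normc q < 1 -> 1 - q ^+ n != 0.
Proof.
move=> n0 q1; rewrite subr_eq0; apply/eqP => /(congr1 normc).
rewrite Normc.normc1 normcX => E.
by have := exprn_ilt1 n (normc_ge0 q) q1; rewrite -E ltxx -lt0n n0.
Qed.

(** The identity (1 - q^n) f = 1 + q^n holds exactly for partial sums when the second one is cut n
    terms earlier; the length k+1+n makes sure that orders 0 and n are both reached. *)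
Lemma overfactor_partial_sum q n k : (0 < n)%N ->
  let s := series (fun m => fps_overfactor C n m * q ^+ m : C) in
  s (k.+1 + n)%N - q ^+ n * s k.+1 = 1 + q ^+ n.
Proof.
move=> n0 s; set f := fps_overfactor C n in s *.
have fE m : f m - (if (n <= m)%N then f (m - n)%N else 0) = (m == 0)%:R + (m == n)%:R.
  have := congr1 (@^~ m) (fps_overfactorE C n0).
  by rewrite mulrBl mul1r coef_fpsD coef_fpsN coef_fpsXnM.
have -> : q ^+ n * s k.+1 =
    \sum_(0 <= m < k.+1 + n) (if (n <= m)%N then f (m - n)%N else 0) * q ^+ m.
  rewrite (big_cat_nat (n := n)) //= ?leq_addl // big_nat big1 ?add0r; last first.
    by move=> m /andP[_ lt_mn]; rewrite leqNgt lt_mn mul0r.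
  rewrite -{2}[n]add0n big_addn addnK /s /series /= mulr_sumr; apply: eq_bigr => m _.
  by rewrite leq_addl addnK exprD; ring.
rewrite /s /series /= -sumrB.
under eq_bigr do rewrite -mulrBl fE.
under eq_bigr do rewrite mulrDl.
have dsum j : (j < k.+1 + n)%N ->
    \sum_(0 <= m < k.+1 + n) (m == j)%:R * q ^+ m = q ^+ j :> C.
  move=> lt_j; rewrite big_mkord (bigD1 (Ordinal lt_j)) //= eqxx mul1r big1 ?addr0 //.
  by move=> i /negbTE ne_ij; rewrite -[i == j :> nat]/(i == Ordinal lt_j) ne_ij mul0r.
by rewrite big_split /= !dsum ?expr0 // -{1}[n]add0n ltn_add2r.
Qed.

(** The logarithmic derivative makes the series of the factor converge to the exponential; the limit
    of [overfactor_partial_sum] shows that this sum times 1 - q^n is 1 + q^n. *)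
Lemma overfactor_eq q n : (0 < n)%N -> normc q < 1 ->
  (1 + q ^+ n) / (1 - q ^+ n) = cexp (log_factor n q).
Proof.
move=> n0 q1; pose s := series (fun m => fps_overfactor C n m * q ^+ m : C).
have cs : s @ \oo --> (cexp (log_factor n q) : C).
  rewrite -[log_factor n q]mul1r; apply: cvg_theta_series => //.
  - exact: quadratic_odd_multiple.
  - exact: odd_multiple0.
  - exact: coef0_overfactor.
  rewrite theta_overfactor //; congr (_ * _).
  by apply/funext => m; rewrite /fps_scale mul1r.
apply: (mulIf (one_sub_expr_neq0 n0 q1)); rewrite mulfVK ?one_sub_expr_neq0 //.
have c1 : s (k.+1 + n)%N @[k --> \oo] --> (cexp (log_factor n q) : C).
  by rewrite (@cvg_shiftS C (fun k => s (k + n)%N)) (@cvg_shiftn n C s).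
have c2 : q ^+ n * s k.+1 @[k --> \oo] --> (q ^+ n * cexp (log_factor n q) : C).
  by apply: cvgM; [exact: cvg_cst | rewrite (@cvg_shiftS C s)].
have cl : (fun k => s (k.+1 + n)%N - q ^+ n * s k.+1) @ \oo -->
    (cexp (log_factor n q) - q ^+ n * cexp (log_factor n q) : C).
  exact: (@cvgB _ C _ _ _ _ _ _ _ c1 c2).
have E : (fun k => s (k.+1 + n)%N - q ^+ n * s k.+1) = fun=> 1 + q ^+ n.
  by apply/funext => k; exact: overfactor_partial_sum.
rewrite E in cl.
rewrite (cvg_unique (@norm_hausdorff _ C) (@cvg_cst C _ _ _ _) cl).
by rewrite mulrBr mulr1 [X in _ - X]mulrC.
Qed.

Lemma overprod_partE q N : normc q < 1 ->
  overprod_part q N = cexp (\sum_(1 <= n < N.+1) log_factor n q).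
Proof.
move=> q1; rewrite cexp_sum /overprod_part !big_nat; apply: eq_bigr => n /andP[n0 _].
exact: overfactor_eq.
Qed.

(** Turns a finite sum of logarithms into one power series, which can be compared termwise with that
    of [log_overprod]. *)
Lemma cvg_log_part q N : normc q < 1 ->
  series (log_term (fun m => \sum_(1 <= n < N.+1) odd_multiple n m)%N q) @ \oo -->
    (\sum_(1 <= n < N.+1) log_factor n q : C).
Proof.
move=> q1; elim: N => [|N IH].
  rewrite big_geq // (_ : series _ = fun=> 0); first exact: cvg_cst.
  apply/funext => M; rewrite /series /= big1 // => m _.
  by rewrite /log_term big_geq // !mul0r.
have -> : \sum_(1 <= n < N.+2) log_factor n q =
  \sum_(1 <= n < N.+1) log_factor n q + log_factor N.+1 q by rewrite big_nat_recr.
have -> : series (log_term (fun m => \sum_(1 <= n < N.+2) odd_multiple n m)%N q) =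
    series (log_term (fun m => \sum_(1 <= n < N.+1) odd_multiple n m)%N q) +
    series (log_term (odd_multiple N.+1) q).
  apply/funext => M; rewrite fctE /series /= -big_split; apply: eq_bigr => m _ /=.
  by rewrite /log_term big_nat_recr //= natrD !mulrDl.
have cN := cvg_log_series (quadratic_odd_multiple N.+1) q1.
exact: (@cvgD _ C _ _ _ _ _ _ _ IH cN).
Qed.

(** The logarithm of the N-th partial product has the coefficients of [log_overprod] up to order N,
    and coefficients between 0 and those beyond. The error is thus at most the tail after N of an
    absolutely convergent series. *)
Lemma cvg_log_overprod q : normc q < 1 ->
  \sum_(1 <= n < N.+1) log_factor n q @[N --> \oo] --> (log_overprod q : C).
Proof.
move=> q1; pose t m := normc (log_term sigmabar_pos q m).
have t_ge0 m : 0 <= t m by exact: normc_ge0.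
have [B HB] := log_term_bounded q1.
have St_nd : nondecreasing_seq (series t).
  by apply/nondecreasing_seqP => n; rewrite [leRHS]seriesSr lerDl.
have St_cvg : cvgn (series t).
  apply: nondecreasing_is_cvgn => //; exists B => _ [n _ <-].
  by rewrite /series /= big_mkord; exact: HB quadratic_sigmabar n.
apply: (@cvgC_squeeze _ _ _ _ _ _ (fun N => limn (series t) - series t N.+1)).
  apply: nearW => N; pose h m := (\sum_(1 <= n < N.+1) odd_multiple n m)%N.
  apply: (@normc_lim_le _ (series (log_term h q) - series (log_term sigmabar_pos q))).
    move=> M; rewrite fctE /=.
    rewrite lerBrDr (le_trans _ (nondecreasing_cvgn_le St_nd St_cvg (maxn M N.+1))) //.
    pose v m := normc (log_term h q m - log_term sigmabar_pos q m).
    have v_ge0 m : 0 <= v m by exact: normc_ge0.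
    have v0 m : (m <= N)%N -> v m = 0.
      move=> le_mN; rewrite /v (_ : log_term h q m = log_term sigmabar_pos q m).
        by rewrite subrr Normc.normc0.
      case: m le_mN => [|m] le_mN; first by rewrite /log_term !invr0 !mulr0 !mul0r.
      by rewrite /log_term /h sum_odd_multiple.
    have vt m : v m <= t m.
      case: m => [|m]; first by rewrite v0.
      rewrite /v /t -mulrBl -mulrBl Normc.normcM [leRHS]Normc.normcM.
      rewrite ler_wpM2r ?normc_ge0 // Normc.normcM [leRHS]Normc.normcM.
      rewrite ler_wpM2r ?normc_ge0 // normcB -natrB ?normc_nat; last first.
        exact: sum_odd_multiple_le.
      by rewrite ler_nat leq_subr.
    (* The terms [v] vanish through order N and lie below [t] afterwards, so they fit into the part
       of [series t] beyond N. *)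
    apply: (@le_trans _ _ (\sum_(0 <= m < maxn M N.+1) v m + series t N.+1)).
      rewrite lerD2r (big_cat_nat (n := M)) ?leq_maxl //= -[leLHS]addr0 lerD ?sumr_ge0 //.
      rewrite /series /= -sumrB; exact: normc_sum.
    rewrite (big_cat_nat (n := N.+1)) ?leq_maxr //= big_nat big1 ?add0r; last first.
      by move=> m /andP[_ /v0].
    rewrite /series /= [leRHS](big_cat_nat (n := N.+1)) ?leq_maxr //= [leLHS]addrC lerD2l.
    exact: ler_sum.
  exact: (@cvgB _ C _ _ _ _ _ _ _ (@cvg_log_part q N q1)
    (cvg_log_series quadratic_sigmabar q1)).
rewrite -(subrr (limn (series t))); apply: cvgB; first exact: cvg_cst.
by rewrite (@cvg_shiftS R).
Qed.

Lemma cvg_overprod_part q : normc q < 1 ->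
  overprod_part q @ \oo --> (cexp (log_overprod q) : C).
Proof.
move=> q1; rewrite (_ : overprod_part q =
  fun N => cexp (\sum_(1 <= n < N.+1) log_factor n q)); last first.
  by apply/funext => N; rewrite overprod_partE.
exact: (cvg_cexp (cvg_log_overprod q1)).
Qed.

Lemma overprodE q : normc q < 1 -> overprod q = cexp (log_overprod q).
Proof. by move=> /cvg_overprod_part; apply: cvg_lim; exact: norm_hausdorff. Qed.

(** Evaluating [theta_Pbar] at x gives the scalar equation that [cvg_theta_series] solves. *)
Lemma cvg_Pbar_series x q : normc q < 1 ->
  series (fun n => (Pbar R[i] n).[x] * q ^+ n : C) @ \oo -->
    (cexp (x * log_overprod q) : C).
Proof.
pose f : fps C := fun n => (Pbar R[i] n).[x].
apply: (@cvg_theta_series _ f); rewrite /f ?Pbar0 ?hornerC //.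
  exact: quadratic_sigmabar.
apply/funext => n; rewrite /theta -hornerMn.
have /(congr1 (fun p => p.[x])) := congr1 (@^~ n) (theta_Pbar R[i]).
rewrite {1}/theta => ->; rewrite !coef_fpsM horner_sum; apply: eq_bigr => i _.
rewrite hornerM /fps_scale hornerM hornerX; congr (_ * _ * _).
by case: (nat_of_ord i) => [|m] /=; rewrite ?horner0 // -polyC_natr hornerC.
Qed.

End OverpartitionProduct.

(** * Continuity and uniqueness of the logarithm on the disc *)

Section DiscLog.
Variable R : realType.
Local Notation C := (R[i]^o).
Local Notation normc := (@Normc.normc R).
Implicit Types (q x : C).

(** Termwise, |p^k - q^k| <= k r^(k-1) |p - q| cancels the denominator k and leaves sigmabar(k)
    r^(k-1) <= 2 k^2 r^(k-1), which is summable. *)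
Lemma log_overprod_lipschitz (r : R) : 0 <= r < 1 -> exists B : R,
  forall p q, normc p <= r -> normc q <= r ->
  normc (log_overprod p - log_overprod q) <= B * normc (p - q).
Proof.
move=> /andP[r0 r1]; have [B HB] := square_power_sum_bounded r0 r1.
exists (2 * B) => p q pr qr.
have cp := cvg_log_series (@quadratic_sigmabar) (le_lt_trans pr r1).
have cq := cvg_log_series (@quadratic_sigmabar) (le_lt_trans qr r1).
apply: (@normc_lim_le _ (series (log_term sigmabar_pos p) -
  series (log_term sigmabar_pos q))); last first.
  exact: (@cvgB _ C _ _ _ _ _ _ _ cp cq).
case=> [|n]; rewrite fctE /= /series /= -sumrB.
  rewrite big_geq // Normc.normc0 mulr_ge0 ?normc_ge0 // mulr_ge0 //.
  by have := HB 0%N; rewrite big_ord0.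
apply: le_trans (normc_sum _ _ _) _; rewrite big_mkord big_ord_recl.
rewrite [X in X + _](_ : _ = 0) ?add0r; last first.
  by rewrite /log_term !mul0r subrr Normc.normc0.
apply: (@le_trans _ _ (2 * (\sum_(k < n) (k.+1 * k.+1)%:R * r ^+ k) * normc (p - q))).
  rewrite mulr_sumr mulr_suml; apply: ler_sum => k _.
  rewrite lift0 /log_term -mulrBr Normc.normcM Normc.normcM Normc.normcV !normc_nat.
  apply: le_trans (ler_wpM2l _ (normc_exprB_le _ pr qr)) _; first by rewrite divr_ge0.
  rewrite !mulrA ler_wpM2r ?normc_ge0 // ler_wpM2r ?exprn_ge0 // mulfVK ?pnatr_eq0 //.
  by rewrite -natrM ler_nat mul2n sigmabar_le.
by rewrite ler_wpM2r ?normc_ge0 // ler_wpM2l.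
Qed.

Lemma open_unit_disc : open (@unit_disc R).
Proof.
rewrite (_ : @unit_disc R = ball (0 : C) 1); first exact: ball_open.
by rewrite -ball_normE; apply/seteqP; split => q; rewrite /unit_disc /= sub0r normrN.
Qed.

Lemma continuous_log_overprod q : unit_disc q -> {for q, continuous (@log_overprod R)}.
Proof.
(* The midpoint between |q| and 1 leaves room for a neighbourhood of q inside the disc of radius
   r. *)
move=> /unit_discE q1; pose r := (normc q + 1) / 2.
have r0 : 0 <= r < 1 by have := normc_ge0 q; rewrite /r; lra.
have [B HB] := log_overprod_lipschitz r0.
have idq : p @[p --> q] --> q by apply: cvg_id.
have v0 : B * normc (p - q) @[p --> q] --> (0 : R).
  have n0 : normc (p - q) @[p --> q] --> (0 : R) by move/cvgCP: idq.
  by rewrite -[X in _ --> X](mulr0 B); exact: (cvgM (cvg_cst B) n0).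
apply: cvgC_squeeze v0.
have rq : 0 < r - normc q by rewrite /r; lra.
have /cvgCP/cvgr0Pnorm_lt/(_ _ rq) := idq.
apply: filterS => p; rewrite (ger0_norm (normc_ge0 _)) => pq.
apply: HB; last by rewrite /r; lra.
by rewrite -[p](subrK q) (le_trans (normcD _ _)) // -lerBrDr ltW.
Qed.

Lemma log_overprod0 : log_overprod 0 = 0 :> C.
Proof.
apply: cvg_lim; first exact: norm_hausdorff.
rewrite (_ : series _ = fun=> 0); first exact: cvg_cst.
apply/funext => n; rewrite /series /= big1 // => -[|m] _; rewrite /log_term.
  by rewrite !mul0r.
by rewrite expr0n mulr0.
Qed.

Lemma disc_log_overprod : disc_log (@overprod R) (@log_overprod R).
Proof.
split; last 1 first.
- by move=> q /unit_discE q1; rewrite overprodE.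
- by apply: continuous_in_subspaceT => q; rewrite inE; exact: continuous_log_overprod.
exact: log_overprod0.
Qed.

(** If [D 1 > 0], the intermediate value theorem yields a point where [D] equals min(D 1, 1), a
    number strictly between 0 and pi, where sin is positive. The same argument for -D excludes
    [D 1 < 0]. *)
Lemma sin_path_eq0 (D : R -> R) : {within `[0, 1], continuous D} -> D 0 = 0 ->
  (forall t, t \in `[0, 1] -> sin (D t) = 0) -> D 1 = 0.
Proof.
have key (E : R -> R) : {within `[0, 1], continuous E} -> E 0 = 0 ->
    (forall t, t \in `[0, 1] -> sin (E t) = 0) -> E 1 <= 0.
  move=> cE E0 sE; rewrite leNgt; apply/negP => E1.
  have m0 : 0 < Num.min (E 1) 1 by rewrite lt_min E1 ltr01.
  have [|c cI cm] := @IVT _ E 0 1 (Num.min (E 1) 1) ler01 cE.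
    by rewrite E0 (min_l (ltW E1)) (max_r (ltW E1)) (ltW m0) ge_min lexx.
  have := sE c cI; rewrite cm => s0.
  suff : 0 < sin (Num.min (E 1) 1) by rewrite s0 ltxx.
  apply: sin_gt0_pi; rewrite m0 /=.
  apply: le_lt_trans (_ : 1 < pi); first by rewrite ge_min lexx orbT.
  by apply: lt_le_trans (pi_ge2 R); rewrite ltr1n.
move=> cD D0 sD; apply/eqP; rewrite eq_le key //= -oppr_le0.
apply: (key (fun t => - D t)); rewrite ?D0 ?oppr0 //.
  by move=> t; apply: cvgN; exact: cD.
by move=> t tI; rewrite sinN sD ?oppr0.
Qed.

Lemma cexp_eq1 (z : C) : cexp z = 1 -> sin (complex.Im z) = 0.
Proof.
case: z => a b /= [_ /eqP]; rewrite mulf_eq0 => /orP[|/eqP //].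
by rewrite gt_eqF ?expR_gt0.
Qed.

(* Along a segment from 0 the difference of two logarithms has an imaginary part
   that varies continuously among the zeros of sin. *)
Lemma disc_log_unique (F L1 L2 : C -> C) : disc_log F L1 -> disc_log F L2 ->
  forall q, unit_disc q -> L1 q = L2 q.
Proof.
move=> [c1 z1 e1] [c2 z2 e2] q qd.
have qn : normc q < 1 by exact/unit_discE.
pose path (t : R) : C := t%:C * q.
have pathd t : t \in `[0, 1] -> unit_disc (path t).
  rewrite in_itv /= => /andP[t0 t1]; apply/unit_discE.
  by rewrite Normc.normcM normc_real ger0_norm // (le_lt_trans _ qn) // ler_piMl ?normc_ge0.
have d1 p : unit_disc p -> cexp (L1 p - L2 p) = 1.
  move=> pd; apply: (mulIf (cexp_neq0 (L2 p))).
  by rewrite -cexpD subrK mul1r e1 // e2.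
have cpath t : {for t, continuous path}.
  have n0 : `|s - t| @[s --> t] --> (0 : R).
    rewrite -(normr0 R) -(subrr t); apply: cvg_norm.
    by apply: cvgB; [apply: cvg_id | apply: cvg_cst].
  have v0 : `|s - t| * normc q @[s --> t] --> (0 : R).
    by rewrite -[X in _ --> X](mul0r (normc q)); exact: (cvgM n0 (cvg_cst _)).
  apply: cvgC_squeeze v0; apply: nearW => s.
  by rewrite /path -mulrBl -rmorphB Normc.normcM normc_real.
have cont (L : C -> C) : {within (@unit_disc R), continuous L} ->
    forall t, t \in `[0, 1] -> {for t, continuous (L \o path)}.
  rewrite continuous_open_subspace; last exact: open_unit_disc.
  move=> cL t tI; apply: continuous_comp; first exact: cpath.
  by apply: cL; rewrite inE; exact: pathd.
have Im0 : complex.Im (L1 (path 1) - L2 (path 1)) = 0.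
  apply: (@sin_path_eq0 (fun t => complex.Im (L1 (path t) - L2 (path t)))).
  - apply: continuous_in_subspaceT => t; rewrite inE => tI.
    by apply: cvg_Im; apply: (@cvgB _ C); exact: cont.
  - by rewrite /path mul0r z1 z2 subrr.
  by move=> t tI; apply/cexp_eq1/d1/pathd.
have p1 : path 1 = q by rewrite /path mul1r.
rewrite p1 in Im0; have Ed := d1 q qd.
(* With imaginary part 0 the exponential equation reduces to [expR a = 1]. *)
apply/eqP; rewrite -subr_eq0; move: Im0 Ed; case: (L1 q - L2 q) => a b /= ->.
rewrite cos0 sin0 mulr1 mulr0 => -[] Ea; suff -> : a = 0 by [].
by apply: expR_inj; rewrite Ea expR0.
Qed.

End DiscLog.

Theorem theorem1p5 (R : realType) :
  [/\ (exists F : fps {poly R[i]},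
         fps_cvg (@fps_overprod R[i] {poly R[i]}) F /\
         forall n : nat, Pbar R[i] n = fps_pow F 'X n),
      [/\ forall q : R[i]^o, unit_disc q -> cvgn (overprod_part q),
          exists L : R[i]^o -> R[i]^o, disc_log (@overprod R) L
        & forall L : R[i]^o -> R[i]^o, disc_log (@overprod R) L ->
          forall x q : R[i]^o, unit_disc q ->
            series (fun n : nat => (Pbar R[i] n).[x] * q ^+ n : R[i]^o) @ \oo
              --> cexp (x * L q)]
    & forall n : nat, (0 < n)%N ->
        (Pbar R[i] n)^`() =
          \sum_(1 <= k < n.+1) ((sigmabar k)%:R / k%:R) *: Pbar R[i] (n - k)].
Proof.
have Lo := @disc_log_overprod R; split.
- exists (fps_overprod_lim {poly R[i]}).
  by split; [exact: fps_cvg_overprod | exact: Pbar_pow].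
- split.
  + by move=> q /unit_discE q1; apply/cvgP: (cvg_overprod_part q1).
  + by exists (@log_overprod R).
  + move=> L HL x q qd; rewrite (disc_log_unique HL Lo qd).
    by apply: cvg_Pbar_series; exact/unit_discE.
- exact: deriv_Pbar.
Qed.
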